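(* Let $S\ge 0$ be an integer and suppose that the real-valued coefficients $b^{p,q,r}, a_{p,q,r}^{\tilde p,\tilde q,\tilde r}$ satisfy $$b^{\tilde p,\tilde q,\tilde r}\,b^{p,q,r}=b^{p,q,r}\,a_{p,q,r}^{\tilde p,\tilde q,\tilde r}+b^{\tilde p,\tilde q,\tilde r}\,a_{\tilde p,\tilde q,\tilde r}^{p,q,r}$$ for all indices $0\le p,q,r,\tilde p,\tilde q,\tilde r\le S$. Then the Runge--Kutta resonance-based scheme for the KdV equation and the Runge--Kutta resonance-based scheme for the cubic NLSE, both described in the context, preserve the corresponding quadratic first integrals $$I_0^{[KdV]}[u]=\int_{\mathbb{T}}u^2\,\mathrm{d}x\qquad\text{and}\qquad I_0^{[NLSE]}[u]=\int_{\mathbb{T}}|u|^2\,\mathrm{d}x$$ exactly, whenever $u\in H^{r}$ with $r\ge1$ (KdV) and $r>1/2$ (NLSE), respectively. That is, for $u^n\in H^r$ one has $I_0^{[KdV]}[u^{n+1}]=I_0^{[KdV]}[u^n]$ for the KdV scheme if $r\ge1$, and $I_0^{[NLSE]}[u^{n+1}]=I_0^{[NLSE]}[u^n]$ for the NLSE scheme if $r>1/2$.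
   Context: $\mathbb{T}=\mathbb{R}/(2\pi\mathbb{Z})$, $\hat u_m=\frac1{2\pi}\int_{\mathbb T}e^{-imx}u(x)\,\mathrm{d}x$, and $H^r=H^r(\mathbb{T})$ is the periodic Sobolev space with norm $\|u\|_{H^r}^2=\sum_{m\in\mathbb Z}\langle m\rangle^{2r}|\hat u_m|^2$, where $\langle m\rangle=|m|$ for $m\ne0$ and $\langle 0\rangle=1$. The time step is $\tau>0$, and $u^n\mapsto u^{n+1}$ is one step of the scheme. KdV: the equation is $\partial_tu+\partial_x^3u=\frac12\partial_x(u^2)$ on $\mathbb{T}$, considered for functions of zero mean, $\int_{\mathbb T}u\,\mathrm{d}x=0$. For integers $p\ge0$ and $c\in[0,1]$ define $$\mathcal F^{[KdV]}_p(\tau;c;w)=\frac12\sum_{m\in\mathbb Z}e^{imx}\frac1{\tau^{p+1}}\sum_{a+b=m}\int_0^{c\tau}im\,e^{-3ismab}s^p\,\mathrm{d}s\,\hat w_a\hat w_b .$$ The KdV scheme, with constants $c_q\in[0,1]$ and $a_{p,q,r}^{\tilde p,\tilde q,\tilde r},b^{p,q,r}\in\mathbb{R}$, is $$u^{n+1}=e^{-\tau\partial_x^3}u^n+\tau\sum_{p,q,r=0}^Sb^{p,q,r}e^{-\tau\partial_x^3}K_{p,q,r},\qquad K_{p,q,r}=\mathcal F^{[KdV]}_p\Big(\tau;c_q;u^n+\tau\sum_{\tilde p,\tilde q,\tilde r=0}^Sa_{p,q,r}^{\tilde p,\tilde q,\tilde r}K_{\tilde p,\tilde q,\tilde r}\Big).$$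 NLSE: the equation is the cubic nonlinear Schrödinger equation $i\partial_tu=-\partial_x^2u+\mu|u|^2u$ on $\mathbb{T}$ with $\mu\in\mathbb{R}$. Fix an integer $\sigma\ge1$ and distinct points $0\le\gamma_1<\dots<\gamma_\sigma\le1$; $\mathcal P_\sigma[f]$ denotes the unique interpolating polynomial of degree (at most) $\sigma-1$ with $\mathcal P_\sigma[f](\tau\gamma_j)=f(\tau\gamma_j)$, $j=1,\dots,\sigma$. Set $$\mathcal K_{2\sigma}(s;k,k_1,k_2,k_3)=e^{-2iskk_1}\mathcal P_\sigma[e^{2i\,\cdot\,k_2k_3}](s)+e^{2isk_2k_3}\mathcal P_\sigma[e^{-2i\,\cdot\,kk_1}](s)-\mathcal P_\sigma[e^{2i\,\cdot\,k_2k_3}](s)\,\mathcal P_\sigma[e^{-2i\,\cdot\,kk_1}](s),$$ and, for integers $p\ge0$ and $c\in\mathbb{R}$, $$\mathcal F^{[NLSE,2\sigma]}_p(\tau;c;w)=-i\mu\sum_{k\in\mathbb Z}e^{ikx}\sum_{k+k_1=k_2+k_3}\frac1{\tau^{p+1}}\int_0^{c\tau}\mathcal K_{2\sigma}(s;k,k_1,k_2,k_3)s^p\,\mathrm{d}s\,\overline{\hat w_{k_1}}\hat w_{k_2}\hat w_{k_3}.$$ The NLSE scheme, with constants $c_q,a_{p,q,r}^{\tilde p,\tilde q,\tilde r},b^{p,q,r}\in\mathbb{R}$, is $$u^{n+1}=e^{i\tau\partial_x^2}u^n+\tau\sum_{p,q,r=0}^Sb^{p,q,r}e^{i\tau\partial_x^2}K_{p,q,r},\qquad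 K_{p,q,r}=\mathcal F^{[NLSE,2\sigma]}_p\Big(\tau;c_q;u^n+\tau\sum_{\tilde p,\tilde q,\tilde r=0}^Sa_{p,q,r}^{\tilde p,\tilde q,\tilde r}K_{\tilde p,\tilde q,\tilde r}\Big).$$ *)

(* Defs.v *)
From HB Require Import structures.
From mathcomp Require Import all_boot all_order all_algebra.
From mathcomp Require Import all_classical all_reals all_analysis.
From mathcomp Require Import complex.

Set Implicit Arguments.
Unset Strict Implicit.
Unset Printing Implicit Defensive.

Import Order.TTheory GRing.Theory Num.Theory.
Import numFieldNormedType.Exports.

Local Open Scope classical_set_scope.
Local Open Scope ring_scope.
Local Open Scope complex_scope.

Section ComplexAnalysis.
Context {R : realType}.

Definition expi (t : R) : R[i] := cos t +i* sin t.

(* Real and imaginary parts are summed unconditionally, as the difference of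
   the sums of the positive and negative parts. This is the usual value when
   the family is absolutely summable, and carries no meaning otherwise. *)
Definition rsum {T : choiceType} (D : set T) (f : T -> R) : R :=
  fine (\esum_(i in D) ((EFin \o f)^\+)%E i)
  - fine (\esum_(i in D) ((EFin \o f)^\-)%E i).

Definition csum {T : choiceType} (D : set T) (f : T -> R[i]) : R[i] :=
  rsum D (fun i => complex.Re (f i)) +i* rsum D (fun i => complex.Im (f i)).

Definition cintegral (D : set R) (f : R -> R[i]) : R[i] :=
  (\int[lebesgue_measure]_(x in D) complex.Re (f x)) +i*
  (\int[lebesgue_measure]_(x in D) complex.Im (f x)).

(* Oriented integral: the NLSE nodes c_q, hence the bound c_q tau, may be
   negative. *)
Definition cint_oriented (a b : R) (f : R -> R[i]) : R[i] :=
  if a <= b then cintegral `[a, b] f else - cintegral `[b, a] f.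

End ComplexAnalysis.

Section Torus.
Context {R : realType}.
Implicit Types (u w : R -> R[i]) (m k : int).

(* Functions on the torus are 2 pi-periodic functions on R, integrated over
   one period. *)
Definition period : set R := `[0, 2 * pi].

Definition fourier u m : R[i] :=
  ((2 * pi)^-1)%:C * cintegral period (fun x => expi (- (m%:~R * x)) * u x).

Definition japanese m : R := if m == 0 then 1 else `|m|%:~R.

(* H^r(T), as a subspace of L^2(T); meaningful for 0 <= r. *)
Definition sobolev (r : R) u : Prop :=
  [/\ periodic u (2 * pi),
      measurable_fun setT (fun x => complex.Re (u x)) /\
      measurable_fun setT (fun x => complex.Im (u x)),
      (\int[lebesgue_measure]_(x in period)
         (Normc.normc (u x) ^+ 2)%:E < +oo)%E
    & (\esum_(m in [set: int])
         (japanese m `^ (2 * r) * Normc.normc (fourier u m) ^+ 2)%:E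
       < +oo)%E].

Definition zero_mean u : Prop := cintegral period u = 0.

Definition fourier_series (f : int -> R[i]) (x : R) : R[i] :=
  csum [set: int] (fun m => expi (m%:~R * x) * f m).

Definition fourier_multiplier (phi : int -> R[i]) u : R -> R[i] :=
  fourier_series (fun m => phi m * fourier u m).

(* exp(- tau d_x^3) has symbol exp(- tau (i m)^3) = exp(i tau m^3). *)
Definition airy_flow (tau : R) u : R -> R[i] :=
  fourier_multiplier (fun m => expi (tau * m%:~R ^+ 3)) u.

(* exp(i tau d_x^2) has symbol exp(i tau (i m)^2) = exp(- i tau m^2). *)
Definition schrodinger_flow (tau : R) u : R -> R[i] :=
  fourier_multiplier (fun m => expi (- (tau * m%:~R ^+ 2))) u.

(* The square is not a squared modulus: for real-valued u this is the usual
   L^2 invariant. *)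
Definition I0_kdv u : R[i] := cintegral period (fun x => u x ^+ 2).

Definition I0_nlse u : R :=
  \int[lebesgue_measure]_(x in period) (Normc.normc (u x) ^+ 2).

End Torus.

Section Interpolation.
Context {R : realType}.

Definition interpolates (sigma : nat) (tau : R) (gamma : 'I_sigma -> R)
    (f : R -> R[i]) (P : {poly R[i]}) : Prop :=
  (size P <= sigma)%N /\
  forall j, P.[(tau * gamma j)%:C] = f (tau * gamma j).

Definition interp (sigma : nat) (tau : R) (gamma : 'I_sigma -> R)
    (f : R -> R[i]) : {poly R[i]} :=
  xget 0 [set P | interpolates tau gamma f P].

Lemma interpP (sigma : nat) (tau : R) (gamma : 'I_sigma -> R)
    (f : R -> R[i]) : 0 < tau -> injective gamma ->
  interpolates tau gamma f (interp tau gamma f) /\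
  forall P, interpolates tau gamma f P -> P = interp tau gamma f.
Proof.
move=> tau0 g_inj.
pose x (j : 'I_sigma) : R[i] := (tau * gamma j)%:C.
have x_inj : injective x.
  by move=> i j /complexI /(mulfI (lt0r_neq0 tau0)) /g_inj.
have uniqueness P Q : interpolates tau gamma f P ->
    interpolates tau gamma f Q -> P = Q.
  move=> [sP PE] [sQ QE]; apply/eqP; rewrite -subr_eq0.
  apply/negPn/negP => neq0.
  have roots : all (root (P - Q)) [seq x j | j <- enum 'I_sigma].
    apply/allP => _ /mapP[j _ ->].
    by rewrite rootE hornerD hornerN PE QE subrr.
  have := max_poly_roots neq0 roots.
  rewrite map_inj_uniq ?enum_uniq // size_map size_enum_ord => /(_ isT).
  rewrite ltnNge (leq_trans (size_polyD _ _)) //.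
  by rewrite geq_max sP size_polyN.
pose l (i : 'I_sigma) : {poly R[i]} :=
  \prod_(j < sigma | j != i) ('X - (x j)%:P).
pose L := \sum_(i < sigma) (f (tau * gamma i) / (l i).[x i])%:P * l i.
have lE i j : i != j -> (l i).[x j] = 0.
  move=> neq_ij; rewrite /l horner_prod (bigD1 j) 1?eq_sym //=.
  by rewrite hornerXsubC subrr mul0r.
have l_neq0 i : (l i).[x i] != 0.
  rewrite /l horner_prod; apply/prodf_neq0 => j neq_ji.
  by rewrite hornerXsubC subr_eq0 (inj_eq x_inj) eq_sym.
have size_l i : (size (l i) <= sigma)%N.
  rewrite /l size_prod => [|j _]; last by rewrite polyXsubC_eq0.
  rewrite (eq_bigr (fun=> (2 * 1)%N)) => [|j _]; last by rewrite size_XsubC.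
  rewrite -big_distrr /= sum1_card cardC1 card_ord.
  by case: (sigma) i => [[]//|n i]; rewrite /= mul2n -addnn -addSn addnK.
have LP : interpolates tau gamma f L.
  split=> [|j].
    rewrite (leq_trans (size_sum _ _ _)) //; apply/bigmax_leqP => i _.
    by rewrite mul_polyC (leq_trans (size_scale_leq _ _)).
  rewrite -/(x j) /L horner_sum (bigD1 j) //= big1 => [|i neq_ij].
    by rewrite hornerM hornerC divfK // addr0.
  by rewrite hornerM (lE i j neq_ij) mulr0.
have iP : interpolates tau gamma f (interp tau gamma f).
  exact: (@xgetPex _ 0 [set P | interpolates tau gamma f P]
            (ex_intro _ L LP)).
by split=> // P PP; exact: uniqueness.
Qed.

End Interpolation.

Section ResonanceIntegrators.
Context {R : realType}.
Implicit Types (w : R -> R[i]).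

Definition F_kdv (tau : R) (p : nat) (c : R) w : R -> R[i] := fun x =>
  (2^-1)%:C * fourier_series (fun m : int =>
    (tau ^- p.+1)%:C *
    csum [set ab : int * int | ab.1 + ab.2 = m] (fun ab =>
      cint_oriented 0 (c * tau) (fun s =>
        'i%C * m%:~R * expi (- (3 * s * m%:~R * ab.1%:~R * ab.2%:~R))
        * (s ^+ p)%:C)
      * fourier w ab.1 * fourier w ab.2)) x.

Definition kernel_nlse (sigma : nat) (tau : R) (gamma : 'I_sigma -> R)
    (s : R) (k k1 k2 k3 : int) : R[i] :=
  let e23 t := expi (2 * t * k2%:~R * k3%:~R) in
  let e01 t := expi (- (2 * t * k%:~R * k1%:~R)) in
  let P23 := (interp tau gamma e23).[s%:C] in
  let P01 := (interp tau gamma e01).[s%:C] in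
  e01 s * P23 + e23 s * P01 - P23 * P01.

Definition F_nlse (mu : R) (sigma : nat) (gamma : 'I_sigma -> R) (tau : R)
    (p : nat) (c : R) w : R -> R[i] := fun x =>
  - 'i%C * mu%:C * fourier_series (fun k : int =>
    csum [set l : int * int * int | k + l.1.1 = l.1.2 + l.2] (fun l =>
      let: (k1, k2, k3) := l in
      (tau ^- p.+1)%:C *
      cint_oriented 0 (c * tau) (fun s =>
        kernel_nlse tau gamma s k k1 k2 k3 * (s ^+ p)%:C)
      * (fourier w k1)^* * fourier w k2 * fourier w k3)) x.

End ResonanceIntegrators.

Section RungeKutta.
Context {R : realType} {S : nat}.

Definition weights := 'I_S.+1 -> 'I_S.+1 -> 'I_S.+1 -> R.
Definition stages := 'I_S.+1 -> 'I_S.+1 -> 'I_S.+1 -> R -> R[i].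

Definition combine (d : weights) (K : stages) (x : R) : R[i] :=
  \sum_(p < S.+1) \sum_(q < S.+1) \sum_(r < S.+1) (d p q r)%:C * K p q r x.

(* The implicit stage equations are equalities of classes of functions,
   hence almost everywhere. *)
Definition rk_stage_equations (F : nat -> R -> (R -> R[i]) -> R -> R[i])
    (tau : R) (c : 'I_S.+1 -> R)
    (a : 'I_S.+1 -> 'I_S.+1 -> 'I_S.+1 -> weights)
    (u : R -> R[i]) (K : stages) : Prop :=
  forall p q r, {ae lebesgue_measure, forall x : R,
    K p q r x =
    F p (c q) (fun y => u y + tau%:C * combine (a p q r) K y) x}.

Definition rk_step (flow : (R -> R[i]) -> R -> R[i]) (tau : R) (b : weights)
    (u : R -> R[i]) (K : stages) : R -> R[i] := fun x =>
  flow u x + tau%:C * combine b (fun p q r => flow (K p q r)) x.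

End RungeKutta.
Arguments weights : clear implicits.
Arguments stages : clear implicits.

(* Main.v *)
(* Both invariants are values B(u, u) of a symmetric real-bilinear form that the
   linear flow preserves, and the condition on the coefficients makes the
   Runge-Kutta step preserve B as soon as every stage satisfies B(w, K) = 0,
   where K = F(w). In Fourier variables B(w, F(w)) is an absolutely convergent
   sum. For KdV it runs over a + b + k = 0 and its summand is -i k times a
   symmetric function, so its cyclic symmetrization vanishes; the factor 1/l in
   the bound of the integral of s ^ p exp(i l s) makes the series of F(w)
   absolutely convergent. For NLSE the kernel is bounded and Hermitian under the
   exchange of (k, k1) with (k2, k3), so the pairing of F(w) with w is i times a
   real number.

   Only the summability of the Fourier coefficients of u and of the stages is
   used; it follows from r > 1/2. Parseval's identity for such functions reduces
   to the uniqueness of Fourier coefficients. If all coefficients of g vanish,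
   then the integral of g over any arc vanishes, because the indicator of
   an arc is the bounded pointwise limit of the trigonometric polynomials
   1 - (1 - y ^ n) ^ N, with y = (1 + cos (t - x0)) / 2 and N close to K ^ n;
   differentiating the primitive of g then gives g = 0 almost everywhere. *)

Require Import Defs.
From HB Require Import structures.
From mathcomp Require Import all_boot all_order all_algebra.
From mathcomp Require Import all_classical all_reals all_analysis.
From mathcomp Require Import measurable_realfun complex.
From mathcomp Require Import ring lra zify.

Set Implicit Arguments.
Unset Strict Implicit.
Unset Printing Implicit Defensive.

Import Order.TTheory GRing.Theory Num.Theory.
Import numFieldNormedType.Exports.

Local Open Scope classical_set_scope.
Local Open Scope ring_scope.
Local Open Scope complex_scope.

(** * Unconditional sums *)

(** The obstacle is that [csum] and the integrals have their usual meaning only under absolute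
    convergence, while the nonlinearities nest them: a sum over modes, of sums over a resonance
    fibre, of time integrals. Summability is therefore established over the set of all pairs or
    triples of frequencies, where no constraint ties the indices, and Fubini transfers it to the
    fibres. For the same reason the argument stays with Fourier coefficients: values of functions
    matter only where the two invariants are turned into forms, and the stage equations enter only
    as equalities of coefficients.

    For KdV the derivative costs a factor m = a + b. The time integral oscillates with frequency 3 m
    a b and gains 1 / |m a b|, so the product is bounded when a and b are nonzero; zero mean of the
    stage arguments disposes of the other terms. With k = - m the phase depends only on a b k, which
    is what makes the cyclic symmetrization collapse to the factor a + b + k = 0.

    The NLSE form is only real-bilinear, so the Runge-Kutta algebra is carried out for real
    coefficients and complex values of the form. *)

Section UnconditionalSums.
Context {R : realType}.
Implicit Types T : choiceType.

Lemma summable_fin T (D : set T) (f : T -> \bar R) :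
  (forall i, D i -> (0 <= f i)%E) -> summable D f ->
  (\esum_(i in D) f i)%E \is a fin_num.
Proof.
move=> f0; rewrite summableE; congr (_ \is a fin_num).
by apply: eq_esum => i Di; rewrite gee0_abs // f0.
Qed.

Lemma summable_le T (D : set T) (f g : T -> \bar R) :
  (forall i, D i -> (`|f i| <= `|g i|)%E) -> summable D g -> summable D f.
Proof. by move=> fg; apply: le_lt_trans; apply: le_esum. Qed.

Lemma esumZ T (D : set T) (c : R) (f : T -> \bar R) : 0 <= c ->
  (forall i, D i -> (0 <= f i)%E) ->
  (\esum_(i in D) (c%:E * f i) = c%:E * \esum_(i in D) f i)%E.
Proof.
rewrite le_eqVlt => /predU1P[<-|c0] f0.
  by rewrite mul0e esum1 // => i _; rewrite mul0e.
have le_Z (d : R) (g : T -> \bar R) : 0 < d ->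
    (forall i, D i -> (0 <= g i)%E) ->
    (\esum_(i in D) (d%:E * g i) <= d%:E * \esum_(i in D) g i)%E.
  move=> d0 g0; apply: ge_ereal_sup => _ [X [finX XD]] <-.
  rewrite fsbig_finite //= big_seq -ge0_sume_distrr; last first.
    by move=> i; rewrite in_fset_set // inE => /XD /g0.
  rewrite -big_seq lee_pmul2l //; apply: ereal_sup_ubound; exists X => //.
  by rewrite fsbig_finite.
apply/eqP; rewrite eq_le le_Z //=.
(* The converse inequality is [le_Z] for the factor [c^-1], applied to the family [c * f]. *)
rewrite -[X in (_ * X <= _)%E](@eq_esum _ _ _ (fun i => c^-1%:E * (c%:E * f i)))%E.
  rewrite -lee_pdivlMl //; apply: le_Z; rewrite ?invr_gt0 //.
  by move=> i Di; rewrite mule_ge0 ?lee_fin ?(ltW c0) ?f0.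
by move=> i _; rewrite muleA -EFinM mulVf ?mul1e // gt_eqF.
Qed.

Lemma eq_rsum T (D : set T) (f g : T -> R) :
  (forall i, D i -> f i = g i) -> rsum D f = rsum D g.
Proof.
move=> fg; rewrite /rsum; congr (fine _ - fine _); apply: eq_esum => i Di.
  by rewrite !funeposE /= fg.
by rewrite !funenegE /= fg.
Qed.

(** The positive and negative parts in [rsum] may be replaced by any decomposition into nonnegative
    summable families. Additivity, Fubini and the exchange with integrals all rest on this
    freedom. *)
Lemma rsumB T (D : set T) (g h : T -> R) :
  (forall i, D i -> 0 <= g i) -> (forall i, D i -> 0 <= h i) ->
  summable D (EFin \o g) -> summable D (EFin \o h) ->
  rsum D (fun i => g i - h i) =
    fine (\esum_(i in D) (g i)%:E)%E - fine (\esum_(i in D) (h i)%:E)%E.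
Proof.
move=> g0 h0 sg sh; have := esumB sg sh g0 h0.
have sgh : summable D ((EFin \o g) \- (EFin \o h))%E by exact: summableB.
have pf := summable_fin (fun i _ => funepos_ge0 _ i) (summable_funepos sgh).
have nf := summable_fin (fun i _ => funeneg_ge0 _ i) (summable_funeneg sgh).
rewrite -[X in (X - _)%E]fineK // -[X in (_ - X)%E]fineK //.
rewrite -[in RHS](@fineK _ (\esum_(i in D) (EFin \o g) i)) ?summable_fin //.
rewrite -[in RHS](@fineK _ (\esum_(i in D) (EFin \o h) i)) ?summable_fin //.
by rewrite -!EFinB => -[].
Qed.

Lemma rsumD T (D : set T) (f g : T -> R) :
  summable D (EFin \o f) -> summable D (EFin \o g) ->
  rsum D (fun i => f i + g i) = rsum D f + rsum D g.
Proof.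
move=> sf sg.
have pos (h : T -> R) : (EFin \o h)^\+%E = EFin \o h^\+ by rewrite funerpos.
have neg (h : T -> R) : (EFin \o h)^\-%E = EFin \o h^\- by rewrite funerneg.
have := summable_funepos sf; have := summable_funeneg sf.
have := summable_funepos sg; have := summable_funeneg sg.
rewrite !pos !neg => sgn sgp sfn sfp.
rewrite (@eq_rsum _ _ _ (fun i => (f^\+ i + g^\+ i) - (f^\- i + g^\- i))); last first.
  by move=> i _; rewrite -[LHS]/((f + g) i) -funrDB.
rewrite rsumB; last 4 first.
- by move=> i _; rewrite addr_ge0 ?funrpos_ge0.
- by move=> i _; rewrite addr_ge0 ?funrneg_ge0.
- rewrite (_ : EFin \o _ = ((EFin \o f^\+%R) \+ (EFin \o g^\+%R))%E) //.
  exact: summableD.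
- rewrite (_ : EFin \o _ = ((EFin \o f^\-%R) \+ (EFin \o g^\-%R))%E) //.
  exact: summableD.
under eq_esum do rewrite EFinD.
under [X in _ - fine X]eq_esum do rewrite EFinD.
rewrite !esumD; try by move=> i _; rewrite lee_fin ?funrpos_ge0 ?funrneg_ge0.
rewrite !fineD ?summable_fin //;
  try by move=> i _; rewrite lee_fin ?funrpos_ge0 ?funrneg_ge0.
by rewrite /rsum !pos !neg /=; ring.
Qed.

Lemma rsumZ T (D : set T) (c : R) (f : T -> R) :
  summable D (EFin \o f) -> rsum D (fun i => c * f i) = c * rsum D f.
Proof.
move=> sf; rewrite /rsum.
have pf := summable_fin (fun i _ => funepos_ge0 _ i) (summable_funepos sf).
have nf := summable_fin (fun i _ => funeneg_ge0 _ i) (summable_funeneg sf).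
rewrite (_ : EFin \o _ = (fun i => c%:E * (EFin \o f) i)%E) //.
have [c0|/ltW c0] := leP 0 c.
  rewrite ge0_funeposM // ge0_funenegM // !esumZ // !fineM //.
  by rewrite mulrBr.
rewrite le0_funeposM // le0_funenegM // -EFinN !esumZ ?oppr_ge0 // !fineM //=.
by ring.
Qed.

Lemma normr_rsum T (D : set T) (f : T -> R) : summable D (EFin \o f) ->
  (`|rsum D f|%:E <= \esum_(i in D) `|f i|%:E)%E.
Proof.
move=> sf; have sp := summable_funepos sf; have sn := summable_funeneg sf.
have pf := summable_fin (fun i _ => funepos_ge0 _ i) sp.
have nf := summable_fin (fun i _ => funeneg_ge0 _ i) sn.
have af := sf; rewrite summableE in af.
rewrite -(@fineK _ (\esum_(i in D) `|f i|%:E)%E) // lee_fin.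
rewrite (@eq_esum _ _ _ _
  (fun i => (EFin \o f)^\+ i + (EFin \o f)^\- i)%E); last first.
  by move=> i _; rewrite -[LHS]/((abse \o (EFin \o f)) i) fune_abse.
rewrite esumD // fineD // /rsum (le_trans (ler_normB _ _)) //.
by rewrite !ger0_norm // fine_ge0 // esum_ge0.
Qed.

Lemma reindex_rsum T T' (P : set T) (Q : set T') (e : T -> T') (f : T' -> R) :
  set_bij P Q e -> rsum Q f = rsum P (f \o e).
Proof.
move=> be; rewrite /rsum compA (funepos_comp (EFin \o f) e) (funeneg_comp (EFin \o f) e).
by rewrite !(reindex_esum P Q e).
Qed.

Lemma summable_fubini (T1 T2 : choiceType) (I : set T1) (J : T1 -> set T2)
    (f : T1 -> T2 -> R) :
  summable (I `*`` J) (fun k => (f k.1 k.2)%:E) ->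
  (forall i, I i -> summable (J i) (EFin \o f i)) /\
  summable I (fun i => \esum_(j in J i) `|f i j|%:E)%E.
Proof.
rewrite /summable -(@esum_esum _ _ _ _ _ (fun i j => `|(f i j)%:E|%E)) // => s.
split; last first.
  apply: le_lt_trans s; apply: le_esum => i _ /=.
  by rewrite gee0_abs // esum_ge0.
move=> i Ii.
have := @summable_pinfty _ _ I (fun i => \esum_(j in J i) `|(f i j)%:E|)%E.
rewrite /summable => /(_ _ i Ii) h.
apply: le_lt_trans (h _).
  by rewrite gee0_abs // esum_ge0.
apply: le_lt_trans s; apply: le_esum => k _ /=.
by rewrite gee0_abs // esum_ge0.
Qed.

(** Tonelli for the two parts of [f] separately. The inner sums of these parts need not be the two
    parts of the inner [rsum], hence the detour through [rsumB]. *)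
Lemma rsum_fubini (T1 T2 : choiceType) (I : set T1) (J : T1 -> set T2)
    (f : T1 -> T2 -> R) :
  summable (I `*`` J) (fun k => (f k.1 k.2)%:E) ->
  rsum I (fun i => rsum (J i) (f i)) = rsum (I `*`` J) (fun k => f k.1 k.2).
Proof.
move=> s; have [s1 s2] := summable_fubini s.
have pf i : I i -> (\esum_(j in J i) (EFin \o f i)^\+ j)%E \is a fin_num.
  by move=> Ii; apply: summable_fin => //; apply: summable_funepos; exact: s1.
have nf i : I i -> (\esum_(j in J i) (EFin \o f i)^\- j)%E \is a fin_num.
  by move=> Ii; apply: summable_fin => //; apply: summable_funeneg; exact: s1.
rewrite [LHS]rsumB; last 4 first.
- by move=> i Ii; rewrite fine_ge0 ?esum_ge0.
- by move=> i Ii; rewrite fine_ge0 ?esum_ge0.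
- apply: summable_le s2 => i Ii.
  rewrite [X in (`|X| <= _)%E](_ : _ = \esum_(j in J i) (EFin \o f i)^\+ j)%E;
    last by rewrite /= fineK ?pf.
  rewrite !gee0_abs ?esum_ge0 //; apply: le_esum => j _.
  by rewrite -[X in (_ <= X)%E]/((abse \o (EFin \o f i)) j) fune_abse leeDl.
- apply: summable_le s2 => i Ii.
  rewrite [X in (`|X| <= _)%E](_ : _ = \esum_(j in J i) (EFin \o f i)^\- j)%E;
    last by rewrite /= fineK ?nf.
  rewrite !gee0_abs ?esum_ge0 //; apply: le_esum => j _.
  by rewrite -[X in (_ <= X)%E]/((abse \o (EFin \o f i)) j) fune_abse leeDr.
rewrite /rsum; congr (fine _ - fine _).
  transitivity (\esum_(i in I) \esum_(j in J i) (EFin \o f i)^\+ j)%E.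
    by apply: eq_esum => i Ii; rewrite fineK ?pf.
  by rewrite esum_esum //; apply: eq_esum => k _; rewrite !funeposE.
transitivity (\esum_(i in I) \esum_(j in J i) (EFin \o f i)^\- j)%E.
  by apply: eq_esum => i Ii; rewrite fineK ?nf.
by rewrite esum_esum //; apply: eq_esum => k _; rewrite !funenegE.
Qed.

End UnconditionalSums.

Section ComplexNorm.
Context {R : realType}.
Implicit Types z w : R[i].

Local Notation normc := Normc.normc.

Lemma complexP z w :
  complex.Re z = complex.Re w -> complex.Im z = complex.Im w -> z = w.
Proof. by case: z w => [a b] [c d] /= -> ->. Qed.

Lemma ReD z w : complex.Re (z + w) = complex.Re z + complex.Re w.
Proof. by case: z w => [a b] [c d]. Qed.

Lemma ImD z w : complex.Im (z + w) = complex.Im z + complex.Im w.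
Proof. by case: z w => [a b] [c d]. Qed.

Lemma ReN z : complex.Re (- z) = - complex.Re z.
Proof. by case: z. Qed.

Lemma ImN z : complex.Im (- z) = - complex.Im z.
Proof. by case: z. Qed.

Lemma ReM z w : complex.Re (z * w) =
  complex.Re z * complex.Re w - complex.Im z * complex.Im w.
Proof. by case: z w => [a b] [c d]. Qed.

Lemma ImM z w : complex.Im (z * w) =
  complex.Re z * complex.Im w + complex.Im z * complex.Re w.
Proof. by case: z w => [a b] [c d]. Qed.

Lemma normc_ge0 z : 0 <= normc z.
Proof. by case: z => a b; exact: sqrtr_ge0. Qed.

Lemma sqr_normcE z : normc z ^+ 2 = complex.Re z ^+ 2 + complex.Im z ^+ 2.
Proof. by case: z => a b /=; rewrite sqr_sqrtr // addr_ge0 ?sqr_ge0. Qed.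

Lemma normr_Re_le z : `|complex.Re z| <= normc z.
Proof.
rewrite -(ler_pXn2r (_ : 0 < 2)%N) ?nnegrE ?normc_ge0 //.
by rewrite sqr_normcE real_normK ?num_real // lerDl sqr_ge0.
Qed.

Lemma normr_Im_le z : `|complex.Im z| <= normc z.
Proof.
rewrite -(ler_pXn2r (_ : 0 < 2)%N) ?nnegrE ?normc_ge0 //.
by rewrite sqr_normcE real_normK ?num_real // lerDr sqr_ge0.
Qed.

Lemma normc_le_ReIm z : normc z <= `|complex.Re z| + `|complex.Im z|.
Proof.
rewrite -(ler_pXn2r (_ : 0 < 2)%N) ?nnegrE ?normc_ge0 ?addr_ge0 //.
rewrite sqr_normcE -(real_normK (num_real (complex.Re z))).
rewrite -(real_normK (num_real (complex.Im z))) sqrrD addrAC lerDl.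
by rewrite mulrn_wge0 // mulr_ge0.
Qed.

Lemma normc_real (x : R) : normc x%:C = `|x|.
Proof. by rewrite /= expr0n addr0 sqrtr_sqr. Qed.

(* In [ring_scope], [z^*] is [Num.conj]; in [complex_scope] it is [conjc]. *)
Lemma conjCE z : (z^*)%R = z^*.
Proof. by []. Qed.

Lemma conjM z w : ((z * w)^*)%R = (z^*)%R * (w^*)%R.
Proof. exact: rmorphM. Qed.

Lemma conjD z w : ((z + w)^*)%R = (z^*)%R + (w^*)%R.
Proof. exact: rmorphD. Qed.

Lemma conj_real (x : R) : ((x%:C)^*)%R = x%:C.
Proof. by rewrite conjCE conjc_real. Qed.

Lemma normc_conj z : normc (z^*)%R = normc z.
Proof. by rewrite conjCE; case: z => a b /=; rewrite sqrrN. Qed.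

Lemma normc_i : normc 'i = 1 :> R.
Proof. by rewrite /= expr0n add0r expr1n sqrtr1. Qed.

End ComplexNorm.

Section ComplexSums.
Context {R : realType}.
Implicit Types T : choiceType.

Local Notation normc := Normc.normc.

Definition csummable T (D : set T) (f : T -> R[i]) :=
  summable D (fun i => (normc (f i))%:E).

Lemma csummable_Re T (D : set T) f : csummable D f ->
  summable D (EFin \o (fun i => complex.Re (f i))).
Proof.
apply: summable_le => i _ /=.
by rewrite lee_fin [leRHS]ger0_norm ?normc_ge0 ?normr_Re_le.
Qed.

Lemma csummable_Im T (D : set T) f : csummable D f ->
  summable D (EFin \o (fun i => complex.Im (f i))).
Proof.
apply: summable_le => i _ /=.
by rewrite lee_fin [leRHS]ger0_norm ?normc_ge0 ?normr_Im_le.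
Qed.

Lemma csummable_le T (D : set T) (f g : T -> R[i]) :
  (forall i, D i -> normc (f i) <= normc (g i)) ->
  csummable D g -> csummable D f.
Proof.
move=> fg; apply: summable_le => i Di /=.
by rewrite lee_fin !ger0_norm ?normc_ge0 ?fg.
Qed.

Lemma csummableD T (D : set T) (f g : T -> R[i]) :
  csummable D f -> csummable D g -> csummable D (fun i => f i + g i).
Proof.
move=> sf sg; apply: summable_le (summableD sf sg) => i _ /=.
rewrite lee_fin !ger0_norm ?addr_ge0 ?normc_ge0 //.
exact: le_normcD.
Qed.

Lemma csummableZ T (D : set T) (c : R[i]) (f : T -> R[i]) :
  csummable D f -> csummable D (fun i => c * f i).
Proof.
move=> sf; rewrite /csummable /summable.
rewrite (@eq_esum _ _ _ _ (fun i => (normc c)%:E * `|(normc (f i))%:E|)%E).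
  by rewrite esumZ ?normc_ge0 // lte_mul_pinfty ?lee_fin ?normc_ge0.
by move=> i _ /=; rewrite Normc.normcM normrM [`|normc c|]ger0_norm ?normc_ge0.
Qed.

Lemma eq_csum T (D : set T) (f g : T -> R[i]) :
  (forall i, D i -> f i = g i) -> csum D f = csum D g.
Proof.
by move=> fg; rewrite /csum; congr (_ +i* _); apply: eq_rsum => i /fg ->.
Qed.

Lemma csumD T (D : set T) (f g : T -> R[i]) :
  csummable D f -> csummable D g ->
  csum D (fun i => f i + g i) = csum D f + csum D g.
Proof.
move=> sf sg; apply: complexP; rewrite ?ReD ?ImD /=.
  by under eq_rsum do rewrite ReD; rewrite rsumD //; exact: csummable_Re.
by under eq_rsum do rewrite ImD; rewrite rsumD //; exact: csummable_Im.
Qed.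

Lemma csumZ T (D : set T) (c : R[i]) (f : T -> R[i]) :
  csummable D f -> csum D (fun i => c * f i) = c * csum D f.
Proof.
move=> sf; have sr := csummable_Re sf; have si := csummable_Im sf.
have sZ (d : R) (h : T -> R) : summable D (EFin \o h) ->
    summable D (EFin \o (fun i => d * h i)).
  move=> sh; rewrite /summable.
  rewrite (@eq_esum _ _ _ _ (fun i => `|d|%:E * `|(EFin \o h) i|)%E).
    by rewrite esumZ // lte_mul_pinfty ?lee_fin.
  by move=> i _ /=; rewrite normrM.
apply: complexP; rewrite ?ReM ?ImM /=.
  under eq_rsum do rewrite ReM -mulNr.
  by rewrite rsumD ?sZ // !rsumZ // mulNr.
under eq_rsum do rewrite ImM.
by rewrite rsumD ?sZ // !rsumZ.
Qed.

Lemma csum_conj T (D : set T) (f : T -> R[i]) : csummable D f ->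
  csum D (fun i => ((f i)^*)%R) = ((csum D f)^*)%R.
Proof.
move=> sf; under eq_csum do rewrite conjCE; rewrite conjCE; apply: complexP => /=.
  by apply: eq_rsum => i _; case: (f i).
rewrite -mulN1r -rsumZ; last exact: csummable_Im.
by apply: eq_rsum => i _; case: (f i) => a b /=; rewrite mulN1r.
Qed.

Lemma csum_reindex T T' (P : set T) (Q : set T') (e : T -> T')
    (f : T' -> R[i]) : set_bij P Q e -> csum Q f = csum P (f \o e).
Proof. by move=> be; rewrite /csum !(reindex_rsum _ be). Qed.

Lemma csummable_reindex T T' (P : set T) (Q : set T') (e : T -> T')
    (f : T' -> R[i]) :
  set_bij P Q e -> csummable Q f = csummable P (f \o e).
Proof. by move=> be; rewrite /csummable /summable (reindex_esum P Q e). Qed.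

Lemma csum_fubini (T1 T2 : choiceType) (I : set T1) (J : T1 -> set T2)
    (f : T1 -> T2 -> R[i]) :
  csummable (I `*`` J) (fun k => f k.1 k.2) ->
  csum I (fun i => csum (J i) (f i)) = csum (I `*`` J) (fun k => f k.1 k.2).
Proof.
move=> sf; rewrite {1 3}/csum /=; congr (_ +i* _).
  by rewrite (@rsum_fubini _ _ _ _ _ (fun i j => complex.Re (f i j)) (csummable_Re sf)).
by rewrite (@rsum_fubini _ _ _ _ _ (fun i j => complex.Im (f i j)) (csummable_Im sf)).
Qed.

Lemma csummable_fubini (T1 T2 : choiceType) (I : set T1) (J : T1 -> set T2)
    (f : T1 -> T2 -> R[i]) :
  csummable (I `*`` J) (fun k => f k.1 k.2) ->
  (forall i, I i -> csummable (J i) (f i)) /\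
  csummable I (fun i => csum (J i) (f i)).
Proof.
move=> sf; have [s1 s2] := @summable_fubini _ _ _ _ _ (fun i j => normc (f i j)) sf.
have s1' i : I i -> csummable (J i) (f i) by exact: s1.
(* Real and imaginary parts are summed separately, so the modulus of an inner sum is estimated by
   twice the sum of the moduli. *)
split=> //; apply: summable_le (summableD s2 s2) => i Ii.
have n0 : (0 <= \esum_(j in J i) `|normc (f i j)|%:E)%E by exact: esum_ge0.
rewrite !gee0_abs ?adde_ge0 ?lee_fin ?normc_ge0 //.
apply: (@le_trans _ _ (`|complex.Re (csum (J i) (f i))|%:E
                     + `|complex.Im (csum (J i) (f i))|%:E)%E).
  by rewrite -EFinD lee_fin normc_le_ReIm.
apply: leeD => /=.
  apply: le_trans (normr_rsum (csummable_Re (s1' i Ii))) _.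
  apply: le_esum => j _.
  by rewrite lee_fin [leRHS]ger0_norm ?normc_ge0 ?normr_Re_le.
apply: le_trans (normr_rsum (csummable_Im (s1' i Ii))) _.
apply: le_esum => j _.
by rewrite lee_fin [leRHS]ger0_norm ?normc_ge0 ?normr_Im_le.
Qed.

Lemma csummableM (T1 T2 : choiceType) (f : T1 -> R[i]) (g : T2 -> R[i]) :
  csummable setT f -> csummable setT g ->
  csummable setT (fun k => f k.1 * g k.2).
Proof.
move=> sf sg; rewrite /csummable /summable.
rewrite (_ : setT = (setT : set T1) `*`` (fun=> setT : set T2)); last first.
  by apply/seteqP; split.
rewrite -(@esum_esum _ _ _ _ _ (fun i j => `|(normc (f i * g j))%:E|%E)) //.
set G := (\esum_(j in [set: T2]) `|(normc (g j))%:E|)%E.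
have G0 : G \is a fin_num by rewrite /G -summableE.
have Gge0 : 0 <= fine G by rewrite fine_ge0 ?esum_ge0.
rewrite (@eq_esum _ _ _ _ (fun i => (fine G)%:E * `|(normc (f i))%:E|)%E).
  by rewrite esumZ // lte_mul_pinfty ?lee_fin.
move=> i _; rewrite fineK // muleC /= -esumZ //=; apply: eq_esum => j _.
by rewrite Normc.normcM normrM.
Qed.

Lemma csummable_bound T (D : set T) (C : R) (f g : T -> R[i]) :
  (forall i, D i -> normc (f i) <= C * normc (g i)) ->
  csummable D g -> csummable D f.
Proof.
move=> fg sg; have : csummable D (fun i => C%:C * g i) by exact: csummableZ.
apply: csummable_le => i Di; rewrite (le_trans (fg i Di)) //.
by rewrite Normc.normcM normc_real ler_wpM2r ?normc_ge0 ?ler_norm.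
Qed.

End ComplexSums.

(** * Integration of complex functions and of series *)

Section IntegralOfSum.
Context {R : realType}.

(** Lists the integers as 0, -1, 1, -2, 2, ..., so that sums over [int] become series over [nat], to
    which monotone convergence applies. *)
Definition int_of_code (n : nat) : int := if odd n then Negz n./2 else Posz n./2.

Lemma int_of_code_bij : set_bij [set: nat] [set: int] int_of_code.
Proof.
split=> // [m n _ _|[k|k] _].
- rewrite /int_of_code => mn.
  have [om hm] : odd m = odd n /\ m./2 = n./2.
    by move: mn; case: (odd m); case: (odd n) => // -[->].
  by rewrite -(odd_double_half m) -(odd_double_half n) om hm.
- by exists k.*2 => //; rewrite /int_of_code odd_double doubleK.
- by exists k.*2.+1 => //; rewrite /int_of_code /= odd_double uphalf_double.
Qed.

Context {d : measure_display} {T : measurableType d}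
  (mu : {measure set T -> \bar R}) (D : set T) (mD : measurable D).

Lemma ge0_measurable_esum (f : int -> T -> \bar R) :
  (forall m, measurable_fun D (f m)) ->
  (forall m x, D x -> (0 <= f m x)%E) ->
  measurable_fun D (fun x => \esum_(m in [set: int]) f m x)%E.
Proof.
move=> mf f0.
apply: (@eq_measurable_fun _ _ _ _ _
    (fun x => \sum_(n <oo) f (int_of_code n) x)%E).
  move=> x /[!inE] Dx.
  by rewrite (reindex_esum _ _ _ _ int_of_code_bij) nneseries_esumT // => n; exact: f0.
by apply: ge0_emeasurable_sum => // n x Dx _; exact: f0.
Qed.

Lemma ge0_integral_esum (f : int -> T -> \bar R) :
  (forall m, measurable_fun D (f m)) ->
  (forall m x, D x -> (0 <= f m x)%E) ->
  (\int[mu]_(x in D) (\esum_(m in [set: int]) f m x) =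
   \esum_(m in [set: int]) \int[mu]_(x in D) f m x)%E.
Proof.
move=> mf f0; rewrite (reindex_esum _ _ _ _ int_of_code_bij) -nneseries_esumT.
  rewrite -integral_nneseries //; last by move=> n x Dx; exact: f0.
  apply: eq_integral => x /[!inE] Dx.
  by rewrite (reindex_esum _ _ _ _ int_of_code_bij) nneseries_esumT // => n; exact: f0.
by move=> n; apply: integral_ge0 => x Dx; exact: f0.
Qed.

(** Tonelli for the sums [P] and [N] of the positive and negative parts. The integrals of [p m] and
    [n m] decompose that of [h m] without being its own parts; [rsumB] accepts this
    decomposition. *)
Lemma Rintegral_rsum (h : int -> T -> R) :
  (forall m, measurable_fun D (h m)) ->
  (forall x, D x -> summable setT (fun m => (h m x)%:E)) ->
  (\esum_(m in [set: int]) \int[mu]_(x in D) `|h m x|%:E < +oo)%E ->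
  mu.-integrable D (EFin \o (fun x => rsum [set: int] (h^~ x))) /\
  \int[mu]_(x in D) rsum [set: int] (h^~ x) =
    rsum [set: int] (fun m => \int[mu]_(x in D) h m x).
Proof.
move=> mh sh sint.
have mEh m : measurable_fun D (EFin \o h m) by exact/measurable_EFinP.
pose p m x : \bar R := ((EFin \o h m)^\+ x)%E.
pose n m x : \bar R := ((EFin \o h m)^\- x)%E.
have mp m : measurable_fun D (p m) by exact: measurable_funepos.
have mn m : measurable_fun D (n m) by exact: measurable_funeneg.
have p0 m x : D x -> (0 <= p m x)%E by move=> _; exact: funepos_ge0.
have n0 m x : D x -> (0 <= n m x)%E by move=> _; exact: funeneg_ge0.
have ple m x : (p m x <= `|h m x|%:E)%E.
  by rewrite -[leRHS]/((abse \o (EFin \o h m)) x) fune_abse leeDl // funeneg_ge0.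
have nle m x : (n m x <= `|h m x|%:E)%E.
  by rewrite -[leRHS]/((abse \o (EFin \o h m)) x) fune_abse leeDr // funepos_ge0.
have mabs m : measurable_fun D (fun x => `|h m x|%:E).
  by apply/measurable_EFinP; exact: measurableT_comp.
have ip_lt m : (\int[mu]_(x in D) p m x <= \int[mu]_(x in D) `|h m x|%:E)%E.
  by apply: ge0_le_integral => //; exact: p0.
have in_lt m : (\int[mu]_(x in D) n m x <= \int[mu]_(x in D) `|h m x|%:E)%E.
  by apply: ge0_le_integral => //; exact: n0.
have ip0 m : (0 <= \int[mu]_(x in D) p m x)%E by apply: integral_ge0 => x; exact: p0.
have in0 m : (0 <= \int[mu]_(x in D) n m x)%E by apply: integral_ge0 => x; exact: n0.
have sip : summable setT (fun m => \int[mu]_(x in D) p m x)%E.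
  apply: le_lt_trans sint; apply: le_esum => m _; rewrite gee0_abs //.
have sin : summable setT (fun m => \int[mu]_(x in D) n m x)%E.
  apply: le_lt_trans sint; apply: le_esum => m _; rewrite gee0_abs //.
pose P x := (\esum_(m in [set: int]) p m x)%E.
pose N x := (\esum_(m in [set: int]) n m x)%E.
have P0 x : D x -> (0 <= P x)%E by move=> Dx; apply: esum_ge0 => m _; exact: p0.
have N0 x : D x -> (0 <= N x)%E by move=> Dx; apply: esum_ge0 => m _; exact: n0.
have PE x : P x = (\esum_(m in [set: int]) (EFin \o (h^~ x))^\+ m)%E.
  by apply: eq_esum => m _; rewrite /p !funeposE.
have NE x : N x = (\esum_(m in [set: int]) (EFin \o (h^~ x))^\- m)%E.
  by apply: eq_esum => m _; rewrite /n !funenegE.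
have Pfin x : D x -> P x \is a fin_num.
  by move=> /sh sx; rewrite PE; apply: summable_fin => //; exact: summable_funepos.
have Nfin x : D x -> N x \is a fin_num.
  by move=> /sh sx; rewrite NE; apply: summable_fin => //; exact: summable_funeneg.
have iP : (\int[mu]_(x in D) P x = \esum_(m in [set: int]) \int[mu]_(x in D) p m x)%E.
  by rewrite ge0_integral_esum.
have iN : (\int[mu]_(x in D) N x = \esum_(m in [set: int]) \int[mu]_(x in D) n m x)%E.
  by rewrite ge0_integral_esum.
have intP : mu.-integrable D P.
  apply/integrableP; split; first exact: ge0_measurable_esum.
  under eq_integral => x /[!inE] Dx do rewrite gee0_abs ?P0 //.
  rewrite iP; apply: le_lt_trans sip; apply: le_esum => m _; exact: lee_abs.
have intN : mu.-integrable D N.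
  apply/integrableP; split; first exact: ge0_measurable_esum.
  under eq_integral => x /[!inE] Dx do rewrite gee0_abs ?N0 //.
  rewrite iN; apply: le_lt_trans sin; apply: le_esum => m _; exact: lee_abs.
have intP' : mu.-integrable D (EFin \o (fine \o P)).
  by apply: eq_integrable intP => // x /[!inE] Dx /=; rewrite fineK ?Pfin.
have intN' : mu.-integrable D (EFin \o (fine \o N)).
  by apply: eq_integrable intN => // x /[!inE] Dx /=; rewrite fineK ?Nfin.
have rE x : rsum [set: int] (h^~ x) = (fine \o P) x - (fine \o N) x.
  by rewrite /rsum /= PE NE.
split.
  apply: eq_integrable (integrableB mD intP' intN') => // x _ /=.
  by rewrite rE EFinB.
under eq_Rintegral do rewrite rE.
rewrite RintegralB //.
have -> : \int[mu]_(x in D) (fine \o P) x = fine (\int[mu]_(x in D) P x)%E.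
  by congr fine; apply: eq_integral => x /[!inE] Dx /=; rewrite fineK ?Pfin.
have -> : \int[mu]_(x in D) (fine \o N) x = fine (\int[mu]_(x in D) N x)%E.
  by congr fine; apply: eq_integral => x /[!inE] Dx /=; rewrite fineK ?Nfin.
have ipf m : (\int[mu]_(x in D) p m x)%E \is a fin_num.
  by rewrite fin_num_abs; apply: summable_pinfty sip _ _.
have inf m : (\int[mu]_(x in D) n m x)%E \is a fin_num.
  by rewrite fin_num_abs; apply: summable_pinfty sin _ _.
rewrite (@eq_rsum _ _ _ _ (fun m => fine (\int[mu]_(x in D) p m x)%E
                                - fine (\int[mu]_(x in D) n m x)%E)); last first.
  move=> m _; rewrite -fineB // /Rintegral; congr fine.
  by rewrite integralE.
rewrite rsumB.
- rewrite iP iN; congr (fine _ - fine _); apply: eq_esum => m _; by rewrite fineK.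
- by move=> m _; rewrite fine_ge0.
- by move=> m _; rewrite fine_ge0.
- rewrite (_ : EFin \o _ = (fun m => \int[mu]_(x in D) p m x)%E) //.
  by apply/funext => m /=; rewrite fineK.
- rewrite (_ : EFin \o _ = (fun m => \int[mu]_(x in D) n m x)%E) //.
  by apply/funext => m /=; rewrite fineK.
Qed.

End IntegralOfSum.

Section ComplexIntegral.
Context {R : realType}.
Implicit Types (D : set R) (f g h : R -> R[i]).

Local Notation normc := Normc.normc.
Local Notation mu := (@lebesgue_measure R).

Definition cmeasurable D f :=
  measurable_fun (D : set (measurableTypeR R)) (fun x => complex.Re (f x)) /\
  measurable_fun (D : set (measurableTypeR R)) (fun x => complex.Im (f x)).

Definition cintegrable D f :=
  mu.-integrable D (EFin \o (fun x => complex.Re (f x))) /\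
  mu.-integrable D (EFin \o (fun x => complex.Im (f x))).

Lemma cmeasurableD D f g : cmeasurable D f -> cmeasurable D g ->
  cmeasurable D (fun x => f x + g x).
Proof.
move=> [rf jf] [rg jg]; split.
  by under eq_fun do rewrite ReD; exact: measurable_funD.
by under eq_fun do rewrite ImD; exact: measurable_funD.
Qed.

Lemma cmeasurableM D f g : cmeasurable D f -> cmeasurable D g ->
  cmeasurable D (fun x => f x * g x).
Proof.
move=> [rf jf] [rg jg]; split.
  under eq_fun do rewrite ReM.
  by apply: measurable_funB; exact: measurable_funM.
under eq_fun do rewrite ImM.
by apply: measurable_funD; exact: measurable_funM.
Qed.

Lemma cmeasurable_cst D (c : R[i]) : cmeasurable D (fun=> c).
Proof. by split; exact: measurable_cst. Qed.

Lemma cmeasurableX D f n : cmeasurable D f -> cmeasurable D (fun x => f x ^+ n).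
Proof.
move=> mf; elim: n => [|n IHn].
  by under eq_fun do rewrite expr0; exact: cmeasurable_cst.
by under eq_fun do rewrite exprS; exact: cmeasurableM.
Qed.

Lemma cmeasurable_integrable D f : cintegrable D f -> cmeasurable D f.
Proof.
move=> [rf jf]; split; apply/measurable_EFinP.
  exact: measurable_int rf.
exact: measurable_int jf.
Qed.

Context {D : set R} (mD : measurable (D : set (measurableTypeR R))).

Lemma eq_cintegrable f g : {in D, f =1 g} -> cintegrable D f -> cintegrable D g.
Proof.
move=> fg [rf jf]; split.
  by apply: (eq_integrable mD _ _ _ rf) => x xD /=; rewrite fg.
by apply: (eq_integrable mD _ _ _ jf) => x xD /=; rewrite fg.
Qed.

Lemma eq_cintegral f g : {in D, f =1 g} -> cintegral D f = cintegral D g.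
Proof.
by move=> fg; congr (_ +i* _); apply: eq_Rintegral => x xD; rewrite fg.
Qed.

Lemma integrable_ReIm f : cintegrable D f ->
  mu.-integrable D (EFin \o (fun x => `|complex.Re (f x)| + `|complex.Im (f x)|)).
Proof.
move=> [rf jf].
rewrite (_ : EFin \o _ = (EFin \o (Num.norm \o (fun x => complex.Re (f x))))
  \+ (EFin \o (Num.norm \o (fun x => complex.Im (f x)))))%E //.
by apply: integrableD => //; exact: integrable_norm.
Qed.

Lemma cintegrable_le f (G : R -> R) : cmeasurable D f ->
  (forall x, D x -> normc (f x) <= G x) ->
  mu.-integrable D (EFin \o G) -> cintegrable D f.
Proof.
move=> [rf jf] fG iG; split; apply: le_integrable iG => //.
- exact/measurable_EFinP.
- move=> x Dx /=; rewrite lee_fin (le_trans (normr_Re_le _)) //.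
  by rewrite (le_trans (fG x Dx)) // ler_norm.
- exact/measurable_EFinP.
- move=> x Dx /=; rewrite lee_fin (le_trans (normr_Im_le _)) //.
  by rewrite (le_trans (fG x Dx)) // ler_norm.
Qed.

Lemma cintegrableM (C : R) f g : cmeasurable D f ->
  (forall x, D x -> normc (f x) <= C) -> cintegrable D g ->
  cintegrable D (fun x => f x * g x).
Proof.
move=> mf fC ig.
apply: (@cintegrable_le _
    (fun x => C * (`|complex.Re (g x)| + `|complex.Im (g x)|))).
- by apply: cmeasurableM => //; exact: cmeasurable_integrable.
- move=> x Dx; rewrite Normc.normcM ler_pM ?normc_ge0 ?fC //.
  exact: normc_le_ReIm.
- rewrite (_ : EFin \o _ = (fun x => C%:E *
    (EFin \o (fun x => `|complex.Re (g x)| + `|complex.Im (g x)|)%R) x))%E //.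
  by apply: integrableZl => //; exact: integrable_ReIm.
Qed.

Lemma cintegrableD f g : cintegrable D f -> cintegrable D g ->
  cintegrable D (fun x => f x + g x).
Proof.
move=> [rf jf] [rg jg]; split.
  apply: (eq_integrable mD _ _ _ (integrableD mD rf rg)) => x _ /=.
  by rewrite ReD EFinD.
apply: (eq_integrable mD _ _ _ (integrableD mD jf jg)) => x _ /=.
by rewrite ImD EFinD.
Qed.

Lemma cintegrableZ (c : R[i]) f : cintegrable D f ->
  cintegrable D (fun x => c * f x).
Proof.
exact: (@cintegrableM (normc c) (fun=> c)).
Qed.

Lemma cintegralD f g : cintegrable D f -> cintegrable D g ->
  cintegral D (fun x => f x + g x) = cintegral D f + cintegral D g.
Proof.
move=> [rf jf] [rg jg]; apply: complexP; rewrite ?ReD ?ImD /=.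
  by under eq_Rintegral do rewrite ReD; rewrite RintegralD.
by under eq_Rintegral do rewrite ImD; rewrite RintegralD.
Qed.

Lemma cintegralZ (c : R[i]) f : cintegrable D f ->
  cintegral D (fun x => c * f x) = c * cintegral D f.
Proof.
move=> [rf jf].
have iZ (k : R) (h : R -> R) : mu.-integrable D (EFin \o h) ->
  mu.-integrable D (EFin \o (fun x => k * h x)) by exact: integrableZl.
apply: complexP; rewrite ?ReM ?ImM /=.
  under eq_Rintegral do rewrite ReM.
  by rewrite RintegralB ?RintegralZl //; exact: iZ.
under eq_Rintegral do rewrite ImM.
by rewrite RintegralD ?RintegralZl //; exact: iZ.
Qed.

Lemma cintegrable_sum (I : Type) (s : seq I) (F : I -> R -> R[i]) :
  (forall i, cintegrable D (F i)) ->
  cintegrable D (fun x => \sum_(i <- s) F i x).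
Proof.
move=> iF; elim: s => [|i s IHs].
  under eq_fun do rewrite big_nil.
  by split; apply: eq_integrable (integrable0 _ _).
under eq_fun do rewrite big_cons.
exact: cintegrableD.
Qed.

Lemma ae_eq_cintegral f g : cmeasurable D f -> cmeasurable D g ->
  {ae mu, forall x, D x -> f x = g x} -> cintegral D f = cintegral D g.
Proof.
move=> [rf jf] [rg jg] fg; congr (_ +i* _); congr fine.
  apply: ae_eq_integral => //; try exact/measurable_EFinP.
  by apply: (@filterS _ _ (ae_filter_ringOfSetsType mu) _ _ _ fg) => x fgx /fgx ->.
apply: ae_eq_integral => //; try exact/measurable_EFinP.
by apply: (@filterS _ _ (ae_filter_ringOfSetsType mu) _ _ _ fg) => x fgx /fgx ->.
Qed.

Lemma cintegrable_bounded (C : R) f : (mu D < +oo)%E -> cmeasurable D f ->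
  (forall x, D x -> normc (f x) <= C) -> cintegrable D f.
Proof.
move=> fD mf fC; apply: (@cintegrable_le _ (fun=> C)) => //.
apply: measurable_bounded_integrable => //.
exists C; split; first by rewrite num_real.
move=> M CM x Dx /=; rewrite ger0_norm ?(ltW CM) //.
by rewrite (le_trans _ (fC x Dx)) ?normc_ge0.
Qed.

Lemma normc_cintegral_le (C : R) f : (mu D < +oo)%E -> cmeasurable D f ->
  (forall x, D x -> normc (f x) <= C) ->
  normc (cintegral D f) <= 2 * C * fine (mu D).
Proof.
move=> fD mf fC; have [rf jf] := cintegrable_bounded fD mf fC.
have bnd (k : R -> R) : mu.-integrable D (EFin \o k) ->
    (forall x, D x -> `|k x| <= C) ->
    `|\int[mu]_(x in D) k x| <= C * fine (mu D).
  move=> ik kC; rewrite (le_trans (le_normr_Rintegral mD ik)) //.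
  rewrite -Rintegral_cst //; apply: le_Rintegral => //.
    exact: integrable_norm.
  apply: measurable_bounded_integrable => //.
  exists `|C|; split; first by rewrite num_real.
  by move=> M CM x Dx /=; rewrite ltW.
rewrite (le_trans (normc_le_ReIm _)) //= -mulrA mulr2n mulrDl !mul1r.
rewrite lerD // bnd // => x Dx.
  by rewrite (le_trans (normr_Re_le _)) ?fC.
by rewrite (le_trans (normr_Im_le _)) ?fC.
Qed.

(** A majorant that separates into a summable sequence and an integrable function yields both the
    summability at each point and that of the integrals. *)
Lemma cintegral_csum (f : int -> R -> R[i]) (c : int -> R) (G : R -> R) :
  (forall m, cmeasurable D (f m)) ->
  mu.-integrable D (EFin \o G) -> (forall x, D x -> 0 <= G x) ->
  (forall m, 0 <= c m) -> summable setT (EFin \o c) ->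
  (forall m x, D x -> normc (f m x) <= c m * G x) ->
  cintegrable D (fun x => csum setT (f^~ x)) /\
  cintegral D (fun x => csum setT (f^~ x)) = csum setT (fun m => cintegral D (f m)).
Proof.
move=> mf iG G0 c0 sc fcG.
have real_case (h : int -> R -> R) :
    (forall m, measurable_fun (D : set (measurableTypeR R)) (h m)) ->
    (forall m x, D x -> `|h m x| <= c m * G x) ->
    mu.-integrable D (EFin \o (fun x => rsum [set: int] (h^~ x))) /\
    \int[mu]_(x in D) rsum [set: int] (h^~ x) =
      rsum [set: int] (fun m => \int[mu]_(x in D) h m x).
  move=> mh hcG; apply: Rintegral_rsum => //.
    move=> x Dx.
    have : (\esum_(m in [set: int]) ((G x)%:E * (EFin \o c) m) < +oo)%E.
      rewrite esumZ ?G0 //; last by move=> m _; rewrite lee_fin.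
      rewrite lte_mul_pinfty ?lee_fin ?G0 //.
      apply: le_lt_trans sc; apply: le_esum => m _; exact: lee_abs.
    apply: le_lt_trans; apply: le_esum => m _ /=.
    by rewrite lee_fin mulrC hcG.
  have IG0 : (0 <= \int[mu]_(x in D) (G x)%:E)%E.
    by apply: integral_ge0 => x Dx; rewrite lee_fin G0.
  have IGfin : (\int[mu]_(x in D) (G x)%:E)%E \is a fin_num.
    exact: integrable_fin_num.
  have : (\esum_(m in [set: int])
      ((fine (\int[mu]_(x in D) (G x)%:E))%:E * (EFin \o c) m) < +oo)%E.
    rewrite esumZ ?fine_ge0 //; last by move=> m _; rewrite lee_fin.
    rewrite lte_mul_pinfty ?lee_fin ?fine_ge0 //.
    apply: le_lt_trans sc; apply: le_esum => m _; exact: lee_abs.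
  apply: le_lt_trans; apply: le_esum => m _ /=.
  rewrite fineK // muleC -integralZl //; apply: ge0_le_integral => //.
  - by apply/measurable_EFinP; exact: measurableT_comp.
  - by apply: measurable_funeM; exact: measurable_int iG.
  - by move=> x Dx; rewrite -EFinM lee_fin hcG.
have [|m x Dx|ir er] := real_case (fun m x => complex.Re (f m x)).
- by move=> m; have [] := mf m.
- by rewrite (le_trans (normr_Re_le _)) ?fcG.
have [|m x Dx|ii ei] := real_case (fun m x => complex.Im (f m x)).
- by move=> m; have [] := mf m.
- by rewrite (le_trans (normr_Im_le _)) ?fcG.
by split=> //; congr (_ +i* _).
Qed.

End ComplexIntegral.

(** * Fourier series *)

Section Expi.
Context {R : realType}.
Implicit Types (s t : R) (m k : int).

Local Notation normc := Normc.normc.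

Lemma expi0 : expi 0 = 1 :> R[i].
Proof. by rewrite /expi cos0 sin0. Qed.

Lemma expiD s t : expi (s + t) = expi s * expi t.
Proof.
by apply: complexP; rewrite ?ReM ?ImM /= ?cosD ?sinD // addrC [cos s * _]mulrC; ring.
Qed.

Lemma expi_conj t : ((expi t)^*)%R = expi (- t).
Proof. by rewrite conjCE /expi /= cosN sinN. Qed.

Lemma normc_expi t : normc (expi t) = 1.
Proof. by rewrite /= cos2Dsin2 sqrtr1. Qed.

Lemma expi_mulN t : expi t * expi (- t) = 1.
Proof. by rewrite -expiD subrr expi0. Qed.

Lemma expi_2pi m : expi (m%:~R * (2 * pi)) = 1 :> R[i].
Proof.
have E1 : expi (2 * pi) = 1 :> R[i].
  by apply: complexP; rewrite /= mulr_natl ?cos2pi ?sin2pi.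
have En n : expi (n%:R * (2 * pi)) = 1 :> R[i].
  elim: n => [|n IHn]; first by rewrite mul0r expi0.
  by rewrite -natr1 mulrDl mul1r expiD IHn E1 mulr1.
case: m => n; first exact: En.
have := expi_mulN (n.+1%:R * (2 * pi) : R); rewrite En mul1r.
by rewrite NegzE mulrNz mulNr.
Qed.

Lemma cmeasurable_expi (D : set R) (f : R -> R) :
  measurable (D : set (measurableTypeR R)) ->
  continuous f -> cmeasurable D (fun x => expi (f x)).
Proof.
move=> mD cf; split; apply: measurable_funS (subsetT D) _ => //;
  apply: continuous_measurable_fun => x; apply: continuous_comp (cf x) _.
  exact: continuous_cos.
exact: continuous_sin.
Qed.

End Expi.

(** * Primitives and oscillatory integrals *)

Section Primitive.
Context {R : realType}.
Implicit Types (T l : R).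

Local Notation normc := Normc.normc.
Local Notation mu := (@lebesgue_measure R).

Lemma Rintegral_is_derive (F f : R -> R) (a b : R) : a < b ->
  continuous f -> (forall x : R, is_derive x 1 F (f x)) ->
  \int[mu]_(x in `[a, b]) f x = F b - F a.
Proof.
move=> ab cf dF; rewrite /Rintegral (@continuous_FTC2 _ _ F) //.
- exact: continuous_subspaceT.
- have cF x : {for x, continuous F}.
    by apply: differentiable_continuous; apply/derivable1_diffP; case: (dF x).
  split=> [x _| |]; first by case: (dF x).
    by apply: cvg_at_right_filter; exact: cF.
  by apply: cvg_at_left_filter; exact: cF.
- by move=> x _; rewrite derive1E; case: (dF x).
Qed.

Lemma is_derive_continuous (F f : R -> R) :
  (forall x : R, is_derive x 1 F (f x)) -> continuous F.
Proof.
move=> dF x; apply: differentiable_continuous; apply/derivable1_diffP.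
by case: (dF x).
Qed.

Lemma is_derive_sinM (l x : R) :
  is_derive x 1 (fun s => sin (l * s)) (l * cos (l * x)).
Proof.
have h : is_derive x 1 (fun s : R => l * s) l.
  by apply: is_derive_eq; rewrite /GRing.scale /=; ring.
by rewrite mulrC; exact: (@is_derive1_comp _ sin _ x _ _ (is_derive_sin _) h).
Qed.

Lemma is_derive_cosM (l x : R) :
  is_derive x 1 (fun s => cos (l * s)) (- (l * sin (l * x))).
Proof.
have h : is_derive x 1 (fun s : R => l * s) l.
  by apply: is_derive_eq; rewrite /GRing.scale /=; ring.
by rewrite mulrC -mulNr; exact: (@is_derive1_comp _ cos _ x _ _ (is_derive_cos _) h).
Qed.

Lemma continuous_sinM (l : R) : continuous (fun s => sin (l * s)).
Proof. exact: is_derive_continuous (is_derive_sinM l). Qed.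

Lemma continuous_cosM (l : R) : continuous (fun s => cos (l * s)).
Proof. exact: is_derive_continuous (is_derive_cosM l). Qed.

Lemma integrable_continuous (a b : R) (f : R -> R) : continuous f ->
  mu.-integrable `[a, b] (EFin \o f).
Proof.
move=> cf; apply: continuous_compact_integrable; first exact: segment_compact.
exact: continuous_subspaceT.
Qed.

(* Integration by parts against the primitive of g, as l * g is the
   derivative of a bounded function. *)
Lemma oscillatory_bound (T : R) (p : nat) : 0 <= T ->
  exists C : R, forall (l : R) (g G : R -> R), l != 0 ->
    (forall x : R, is_derive x 1 G (l * g x)) -> continuous g ->
    (forall x, `|G x| <= 1) ->
    `|\int[mu]_(s in `[0, T]) (s ^+ p * g s)| <= C / `|l|.
Proof.
rewrite le_eqVlt => /predU1P[<-|T0].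
  by exists 0 => l g G _ _ _ _; rewrite set_itv1 Rintegral_set1 normr0 mul0r.
(* The two boundary terms account for [2 * T ^+ p], the remaining integral for the maximum of the
   derivative of [s ^+ p] times the length [T]. The constant does not depend on [l], [g] or [G]. *)
exists (2 * T ^+ p + p%:R * T ^+ p.-1 * T) => l g G l0 dG cg G1.
have cG : continuous G := is_derive_continuous dG.
have cX n : continuous (fun s : R => s ^+ n) by move=> x; exact: exprn_continuous.
have cM (h k : R -> R) : continuous h -> continuous k -> continuous (fun s => h s * k s).
  by move=> ch ck x; apply: cvgM; [exact: ch|exact: ck].
have cl (c : R) : continuous (fun _ : R => c) by move=> x; exact: cvg_cst.
pose h s := p%:R * s ^+ p.-1 * (G s / l).
have ch : continuous h by exact: (cM _ _ (cM _ _ (cl _) (cX _)) (cM _ _ cG (cl _))).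
have dF (x : R) : is_derive x 1 (fun s : R => s ^+ p * (G s / l)) (x ^+ p * g x + h x).
  have dGl : is_derive x 1 (fun s => G s / l) (g x).
    rewrite (_ : (fun s => G s / l) = (l^-1 \*: G)); last first.
      by apply/funext => s; rewrite /= mulrC.
    by apply: is_derive_eq; rewrite /GRing.scale /= mulKf.
  have dX : is_derive x 1 (fun s : R => s ^+ p) (p%:R * x ^+ p.-1).
    rewrite (_ : (fun s : R => s ^+ p) = (@id R) ^+ p); last first.
      by apply/funext => s; rewrite exprfctE.
    by apply: is_derive_eq; rewrite /GRing.scale /= mulr1.
  apply: (is_derive_eq (is_deriveM dX dGl)); rewrite /h /GRing.scale /=; ring.
have cgl : continuous (fun s : R => s ^+ p * g s) by exact: cM.
have := @Rintegral_is_derive _ _ 0 T T0 _ dF.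
rewrite RintegralD //; try exact: integrable_continuous.
move=> E; have -> : \int[mu]_(s in `[0, T]) (s ^+ p * g s) =
   (T ^+ p * (G T / l) - 0 ^+ p * (G 0 / l)) - \int[mu]_(s in `[0, T]) h s.
  rewrite -E ?addrK // => x; apply: cvgD; [exact: cgl|exact: ch].
have Gl x : `|G x / l| <= `|l|^-1.
  by rewrite normrM normfV ler_piMl ?invr_ge0.
have muT : fine (mu `[0, T]%classic) = T.
  by rewrite lebesgue_measure_itv /= lte_fin T0 /= subr0.
rewrite (le_trans (ler_normB _ _)) // [leRHS]mulrDl lerD //.
  rewrite (le_trans (ler_normB _ _)) // !normrM mulr2n mulrDl mul1r mulrDl.
  rewrite lerD // ler_pM //; try by rewrite -normrM.
    by rewrite ger0_norm ?exprn_ge0 ?(ltW T0).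
  by rewrite ger0_norm ?exprn_ge0 // lerXn2r ?nnegrE ?(ltW T0).
have ih : mu.-integrable `[0, T] (EFin \o h) by exact: integrable_continuous.
rewrite (le_trans (le_normr_Rintegral _ ih)) //.
rewrite mulrAC -[X in _ * X]muT -Rintegral_cst //.
apply: le_Rintegral => //; first exact: integrable_norm.
  by apply: integrable_continuous => x; exact: cvg_cst.
move=> x /=; rewrite in_itv /= => /andP[x0 xT].
rewrite /h !normrM normr_nat -!mulrA ler_wpM2l // -normrM ler_pM //.
by rewrite ger0_norm ?exprn_ge0 // lerXn2r ?nnegrE ?(ltW T0).
Qed.

End Primitive.

Section FourierSeries.
Context {R : realType}.
Implicit Types (u g : R -> R[i]) (f : int -> R[i]) (m k : int).

Local Notation normc := Normc.normc.
Local Notation mu := (@lebesgue_measure R).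
Local Notation period := (@period R).

Lemma two_pi_gt0 : 0 < 2 * pi :> R.
Proof. by rewrite mulr_gt0 // pi_gt0. Qed.

Lemma measurable_period : measurable (period : set (measurableTypeR R)).
Proof. exact: measurable_itv. Qed.

Lemma mu_period : mu period = (2 * pi)%:E.
Proof. by rewrite lebesgue_measure_itv /= lte_fin two_pi_gt0 /= sube0. Qed.

Lemma mu_period_lty : (mu period < +oo)%E.
Proof. by rewrite mu_period ltry. Qed.

Lemma cmeasurable_mode (D : set R) (c : R) :
  measurable (D : set (measurableTypeR R)) ->
  cmeasurable D (fun x => expi (c * x)).
Proof. by move=> mD; apply: cmeasurable_expi => //; exact: mulrl_continuous. Qed.

Lemma cintegral_mode m :
  cintegral period (fun x => expi (m%:~R * x)) = if m == 0 then (2 * pi)%:C else 0.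
Proof.
case: eqVneq => [->|m0].
  rewrite (_ : (fun x => _) = fun=> 1); last first.
    by apply/funext => x; rewrite mul0r expi0.
  have cstE r : \int[mu]_(x in period) (fun=> r : R) x = r * (2 * pi).
    rewrite Rintegral_cst; last exact: measurable_period.
    by congr (_ * _); rewrite -[2 * pi]/(fine (2 * pi)%:E) -mu_period.
  by apply: complexP; rewrite /= cstE ?mul1r ?mul0r.
have mR0 : m%:~R != 0 :> R by rewrite intr_eq0.
have [c1 s1] : cos (m%:~R * (2 * pi)) = 1 :> R /\ sin (m%:~R * (2 * pi)) = 0 :> R.
  by have := expi_2pi (R := R) m => -[].
apply: complexP; rewrite /=.
  have dF (x : R) : is_derive x 1 (fun x => sin (m%:~R * x) / m%:~R) (cos (m%:~R * x)).
    have dx := is_derive_sinM m%:~R x.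
    rewrite (_ : (fun s => _) = (m%:~R^-1 \*: (fun x : R => sin (m%:~R * x)))); last first.
      by apply/funext => s; rewrite /= mulrC.
    by apply: is_derive_eq; rewrite /GRing.scale /= mulKf.
  rewrite (Rintegral_is_derive two_pi_gt0 (@continuous_cosM _ _) dF).
  by rewrite s1 mulr0 sin0 !mul0r subrr.
have dF (x : R) : is_derive x 1 (fun x => - (cos (m%:~R * x) / m%:~R)) (sin (m%:~R * x)).
  have dx := is_derive_cosM m%:~R x.
  rewrite (_ : (fun s => _) = (- m%:~R^-1 \*: (fun x : R => cos (m%:~R * x)))); last first.
    by apply/funext => s; rewrite /= /GRing.scale /= mulNr mulrC.
  by apply: is_derive_eq; rewrite /GRing.scale /= mulrNN mulKf.
rewrite (Rintegral_is_derive two_pi_gt0 (@continuous_sinM _ _) dF).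
by rewrite c1 mulr0 cos0 subrr.
Qed.

Lemma csum_single (T : choiceType) (t : T) (F : T -> R[i]) :
  (forall s, s != t -> F s = 0) -> csum setT F = F t.
Proof.
move=> F0.
have r1 (h : T -> R) : (forall s, s != t -> h s = 0) -> rsum setT h = h t.
  move=> h0; have e1 (a : T -> \bar R) : (forall s, (0 <= a s)%E) ->
      (forall s, s != t -> a s = 0%E) -> (\esum_(i in setT) a i)%E = a t.
    move=> a0 at0; rewrite -(esum_set1 (a0 t)) [RHS]esum_mkcond.
    apply: eq_esum => s _; case: ifPn => // /negP; rewrite inE /= => /eqP; exact: at0.
  rewrite /rsum !e1; first last; try by move=> s //; rewrite ?funepos_ge0 ?funeneg_ge0.
  - by move=> s st; rewrite funeposE /= h0 // maxxx.
  - by move=> s st; rewrite funenegE /= h0 // oppr0 maxxx.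
  by rewrite funerpos funerneg /=; exact: (congr1 (@^~ t) (funrposBneg h)).
by apply: complexP => /=; apply: r1 => s /F0 ->.
Qed.

(** Source of all facts on series with summable coefficients: [g = 1] gives integrability, a mode
    for [g] recovers the coefficients, and a general [g] gives Parseval. *)
Lemma fourier_series_pairing f g : csummable setT f -> cintegrable period g ->
  cintegrable period (fun x => g x * fourier_series f x) /\
  cintegral period (fun x => g x * fourier_series f x) =
    csum setT (fun m => f m * cintegral period (fun x => expi (m%:~R * x) * g x)).
Proof.
move=> sf ig; have mP := measurable_period.
pose G x := `|complex.Re (g x)| + `|complex.Im (g x)|.
have ie m : cintegrable period (fun x => expi (m%:~R * x) * g x).
  by apply: (@cintegrableM _ _ _ 1) => // [|x _]; [exact: cmeasurable_mode|rewrite normc_expi].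
have [m||x _|m||m x Dx|i1 i2] := @cintegral_csum _ _ mP
    (fun m x => f m * (expi (m%:~R * x) * g x)) (fun m => normc (f m)) G.
- by apply: cmeasurable_integrable; exact: cintegrableZ.
- exact: integrable_ReIm.
- by rewrite addr_ge0.
- exact: normc_ge0.
- exact: sf.
- by rewrite !Normc.normcM normc_expi mul1r ler_wpM2l ?normc_ge0 // normc_le_ReIm.
have fsE x : g x * fourier_series f x
    = csum setT (fun m => f m * (expi (m%:~R * x) * g x)).
  rewrite /fourier_series -csumZ; last first.
    by apply: csummable_le sf => m _; rewrite Normc.normcM normc_expi mul1r.
  by apply: eq_csum => m _; rewrite mulrC -mulrA mulrCA mulrA.
split.
  by apply: (eq_cintegrable mP _ i1) => x _; rewrite fsE.
rewrite (eq_cintegral (g := fun x => csum setT (fun m => f m * (expi (m%:~R * x) * g x)))).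
  by rewrite i2; apply: eq_csum => m _; rewrite cintegralZ.
by move=> x _; rewrite fsE.
Qed.

Lemma cintegrable_cst (c : R[i]) : cintegrable period (fun=> c).
Proof.
apply: (@cintegrable_bounded _ _ measurable_period (normc c)) => //.
exact: mu_period_lty.
Qed.

Lemma cintegrable_fourier_series f : csummable setT f ->
  cintegrable period (fourier_series f).
Proof.
move=> sf; have [i1 _] := fourier_series_pairing sf (cintegrable_cst 1).
by apply: (eq_cintegrable measurable_period _ i1) => x _; rewrite mul1r.
Qed.

Lemma cintegrable_modeM (c : R) g : cintegrable period g ->
  cintegrable period (fun x => expi (c * x) * g x).
Proof.
move=> ig; apply: (@cintegrableM _ _ measurable_period 1) => // [|x _].
  by apply: cmeasurable_mode; exact: measurable_period.
by rewrite normc_expi.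
Qed.

Lemma fourier_fourier_series f m : csummable setT f ->
  fourier (fourier_series f) m = f m.
Proof.
move=> sf; have [_] := fourier_series_pairing sf
  (cintegrable_modeM (- m%:~R) (cintegrable_cst 1)).
have modeE k : cintegral period
      (fun x => expi (k%:~R * x) * (expi (- m%:~R * x) * 1)) =
    if k - m == 0 then (2 * pi)%:C else 0.
  rewrite -cintegral_mode; apply: eq_cintegral => x _.
  by rewrite mulr1 -expiD -mulrDl rmorphB.
rewrite (csum_single (t := m)) => [|k km]; last first.
  by rewrite modeE subr_eq0 (negPf km) mulr0.
rewrite modeE subrr eqxx /fourier => E.
rewrite (eq_cintegral (g := fun x => expi (- m%:~R * x) * 1 * fourier_series f x)).
  rewrite E mulrCA -rmorphM /= mulVf ?mulr1 //; exact: lt0r_neq0 two_pi_gt0.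
by move=> x _; rewrite mulr1 mulNr.
Qed.

End FourierSeries.

(** * Uniqueness of Fourier coefficients *)

Section PowerIndicator.
Context {R : realType}.

(* 1 - z ^ n lies in [0, 1], so raising it to a power close to K ^ n sends it
   to 1 where K * z < 1 and to 0 where K * z > 1. *)
Definition power_step (K z : R) (n : nat) : R :=
  1 - (1 - z ^+ n) ^+ Num.truncn (K ^+ n).

Lemma bernoulli_ge (z : R) N : 0 <= z <= 1 -> 1 - N%:R * z <= (1 - z) ^+ N.
Proof.
move=> /andP[z0 z1]; elim: N => [|N IHN]; first by rewrite mul0r subr0 expr0.
rewrite exprS (le_trans _ (ler_wpM2l _ IHN)) ?subr_ge0 //.
have : 0 <= N%:R * z ^+ 2 by rewrite mulr_ge0 ?sqr_ge0.
by rewrite -natr1 => h; rewrite -subr_ge0; move: h; congr (_ <= _); ring.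
Qed.

(** The upper companion of Bernoulli's inequality, in product form: [(1 - z) * (1 + (N + 1) * z)]
    falls short of [1 + N * z] by [(N + 1) * z ^ 2]. It drives [power_step] to 1 where [K * z > 1],
    as [bernoulli_ge] drives it to 0 where [K * z < 1]. *)
Lemma bernoulli_le (z : R) N : 0 <= z <= 1 ->
  (1 - z) ^+ N * (1 + N%:R * z) <= 1.
Proof.
move=> /andP[z0 z1]; elim: N => [|N IHN]; first by rewrite mul0r addr0 expr0 mul1r.
apply: le_trans IHN; rewrite exprSr -mulrA ler_wpM2l ?exprn_ge0 ?subr_ge0 //.
have : 0 <= (N%:R + 1) * z ^+ 2 by rewrite mulr_ge0 ?sqr_ge0 // addr_ge0.
by rewrite -natr1 => h; rewrite -subr_ge0; move: h; congr (_ <= _); ring.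
Qed.

Lemma power_step_ge0_le1 (K z : R) n : 0 <= z <= 1 -> 0 <= power_step K z n <= 1.
Proof.
move=> /andP[z0 z1]; rewrite /power_step subr_ge0 lerBlDr lerDl.
have h : 0 <= 1 - z ^+ n <= 1.
  by rewrite subr_ge0 exprn_ile1 // lerBlDr lerDl exprn_ge0.
by move: h => /andP[h0 h1]; rewrite exprn_ile1 // exprn_ge0.
Qed.

Lemma cvg_power_step (K z : R) : 1 < K -> 0 <= z <= 1 -> K * z != 1 ->
  power_step K z @ \oo --> (if K * z < 1 then 0 else 1 : R).
Proof.
move=> K1 z01 Kz1; have /andP[z0 z1] := z01.
have K0 : 0 < K by rewrite (lt_trans _ K1).
have zn n : 0 <= z ^+ n <= 1 by rewrite exprn_ge0 // exprn_ile1.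
have Kn n : 0 <= K ^+ n by rewrite exprn_ge0 ?ltW.
case: ltP => [Kz|]; last rewrite le_eqVlt eq_sym (negPf Kz1) /= => Kz.
  apply: (@squeeze_cvgr _ _ _ _ (fun=> 0) (fun n => (K * z) ^+ n)).
  - near=> n; have /andP[-> _] /= := power_step_ge0_le1 K n z01.
    rewrite /power_step lerBlDr -lerBlDl (le_trans _ (bernoulli_ge _ (zn n))) //.
    by rewrite lerB // exprMn ler_wpM2r ?exprn_ge0 // truncn_le.
  - exact: cvg_cst.
  - by apply: cvg_expr; rewrite ger0_norm ?mulr_ge0 ?(ltW K0).
apply: (@squeeze_cvgr _ _ _ _ (fun n => 1 - (K * z)^-1 ^+ n) (fun=> 1)).
- near=> n; have /andP[_ ->] := power_step_ge0_le1 K n z01; rewrite andbT.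
  rewrite /power_step lerB //.
  have Kzn0 : 0 < (K * z) ^+ n by rewrite exprn_gt0 // (lt_trans _ Kz).
  rewrite exprVn -[leRHS]mul1r ler_pdivlMr //.
  apply: le_trans (bernoulli_le (Num.truncn (K ^+ n)) (zn n)).
  rewrite ler_wpM2l ?exprn_ge0 ?subr_ge0 //; first by have /andP[] := zn n.
  (* The exponent N is a truncation, so only [K ^+ n < N + 1] is known. The extra [z ^+ n] is at
     most 1 and is absorbed by the 1 in [1 + N * z ^+ n]. *)
  have := truncnS_gt (K ^+ n); rewrite -natr1 => /ltW KN.
  rewrite exprMn (le_trans (ler_wpM2r (exprn_ge0 _ z0) KN)) //.
  by rewrite mulrDl mul1r addrC lerD2r; have /andP[] := zn n.
- rewrite -[X in _ --> X]subr0; apply: cvgB; first exact: cvg_cst.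
  apply: cvg_expr; rewrite ger0_norm ?invr_ge0 ?mulr_ge0 ?(ltW K0) //.
  by rewrite invf_lt1 // (lt_trans _ Kz).
- exact: cvg_cst.
Unshelve. all: by end_near. Qed.

End PowerIndicator.

Section FourierUniqueness.
Context {R : realType}.
Implicit Types (h p q : R -> R[i]).

Local Notation normc := Normc.normc.
Local Notation mu := (@lebesgue_measure R).
Local Notation period := (@period R).

Definition modes_vanish h := cintegrable period h /\
  forall m : int, cintegral period (fun x => expi (m%:~R * x) * h x) = 0.

(** Stands in for trigonometric polynomials: these multipliers contain the constants and the modes
    and are closed under sums and products, so [power_step] qualifies without being expanded. *)
Definition vanish_multiplier p :=
  forall h, modes_vanish h -> modes_vanish (fun x => p x * h x).

Let mP := @measurable_period R.

Lemma vanish_multiplier_cst (c : R[i]) : vanish_multiplier (fun=> c).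
Proof.
move=> h [ih h0]; split; first exact: cintegrableZ.
move=> m; under eq_cintegral do rewrite mulrCA.
by rewrite cintegralZ ?h0 ?mulr0 //; exact: cintegrable_modeM.
Qed.

Lemma vanish_multiplierD p q : vanish_multiplier p -> vanish_multiplier q ->
  vanish_multiplier (fun x => p x + q x).
Proof.
move=> vp vq h vh; have [ip p0] := vp h vh; have [iq q0] := vq h vh.
split=> [|m].
  by apply: (eq_cintegrable mP _ (cintegrableD mP ip iq)) => x _; rewrite mulrDl.
under eq_cintegral do rewrite mulrDl mulrDr.
by rewrite cintegralD ?p0 ?q0 ?addr0 //; exact: cintegrable_modeM.
Qed.

Lemma vanish_multiplierM p q : vanish_multiplier p -> vanish_multiplier q ->
  vanish_multiplier (fun x => p x * q x).
Proof.
move=> vp vq h vh; have [ip p0] := vp _ (vq h vh).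
split=> [|m].
  by apply: (eq_cintegrable mP _ ip) => x _; rewrite mulrA.
by under eq_cintegral do rewrite -[p _ * q _ * h _]mulrA; exact: p0.
Qed.

Lemma vanish_multiplierX p n : vanish_multiplier p ->
  vanish_multiplier (fun x => p x ^+ n).
Proof.
move=> vp; elim: n => [|n IHn].
  by under eq_fun do rewrite expr0; exact: vanish_multiplier_cst.
by under eq_fun do rewrite exprS; exact: vanish_multiplierM.
Qed.

Lemma vanish_multiplier_mode (k : int) : vanish_multiplier (fun x => expi (k%:~R * x)).
Proof.
move=> h [ih h0]; split; first exact: cintegrable_modeM.
move=> m; rewrite -[RHS](h0 (m + k)); apply: eq_cintegral => x _.
by rewrite mulrA -expiD -mulrDl rmorphD.
Qed.

Lemma vanish_multiplier_cos (x0 : R) :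
  vanish_multiplier (fun x => (cos (x - x0))%:C).
Proof.
have -> : (fun x => (cos (x - x0))%:C) = (fun x =>
    (expi (- x0) / 2) * expi (1%:~R * x) + (expi x0 / 2) * expi ((-1)%:~R * x)).
  apply/funext => x.
  have e1 : expi (- x0) * expi (1%:~R * x) = expi (x - x0).
    by rewrite -expiD mulr1z mul1r addrC.
  have e2 : expi x0 * expi ((-1)%:~R * x) = (expi (x - x0))^*.
    by rewrite -conjCE expi_conj -expiD mulrN1z mulN1r opprB.
  rewrite [expi (- x0) / 2 * _]mulrAC e1 [expi x0 / 2 * _]mulrAC e2.
  by rewrite -mulrDl addcJ mulrAC mulfV ?mul1r.
by apply: vanish_multiplierD; apply: vanish_multiplierM;
  solve [exact: vanish_multiplier_cst | exact: vanish_multiplier_mode].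
Qed.

Lemma vanish_multiplier_power_step (x0 K : R) n :
  vanish_multiplier (fun x => (power_step K ((1 + cos (x - x0)) / 2) n)%:C).
Proof.
have vN p : vanish_multiplier p -> vanish_multiplier (fun x => 1 - p x).
  move=> vp; under eq_fun do rewrite -mulN1r.
  by apply: vanish_multiplierD; [|apply: vanish_multiplierM => //];
    exact: vanish_multiplier_cst.
under eq_fun do rewrite /power_step rmorphB rmorphXn rmorphB rmorphXn rmorphM rmorphD rmorph1.
apply: (vN (fun x => _ ^+ _)); apply: vanish_multiplierX; apply: (vN (fun x => _ ^+ _)).
apply: vanish_multiplierX; apply: vanish_multiplierM; last exact: vanish_multiplier_cst.
apply: vanish_multiplierD; [exact: vanish_multiplier_cst|exact: vanish_multiplier_cos].
Qed.

End FourierUniqueness.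

Section UniquenessTheorem.
Context {R : realType}.

Local Notation mu := (@lebesgue_measure R).
Local Notation period := (@period R).

(** The arc from 0 to x has midpoint x / 2 and half-length x / 2, and the cosine decreases with the
    distance to the midpoint; the excluded values of [t] are the end points, where equality
    holds. *)
Lemma arc_cos (x t : R) : 0 < x < 2 * pi -> 0 <= t <= 2 * pi ->
  t != 0 -> t != x -> t != 2 * pi ->
  (cos (t - x / 2) < cos (x / 2)) = (x < t) /\ cos (t - x / 2) != cos (x / 2).
Proof.
move=> /andP[x0 x2] /andP[t0 t2] tn0 tnx tn2.
have t0' : 0 < t by rewrite lt_neqAle eq_sym tn0.
have t2' : t < 2 * pi by rewrite lt_neqAle tn2.
have pi0 := @pi_gt0 R.
have hx : x / 2 \in `[0, pi] by rewrite in_itv /=; apply/andP; split; lra.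
case: (ltgtP t x) tnx => // tx _.
  have h : `|t - x / 2| < x / 2 by rewrite ltr_norml; apply/andP; split; lra.
  have hn : `|t - x / 2| \in `[0, pi].
    by rewrite in_itv /= normr_ge0 /=; move: hx; rewrite in_itv /=; lra.
  have := ltr_cos hn hx; rewrite cos_norm h => hc.
  by split; [apply/negbTE; rewrite -leNgt ltW|rewrite gt_eqF].
have [tp|tp] := leP (t - x / 2) pi.
  have hn : t - x / 2 \in `[0, pi] by rewrite in_itv /=; apply/andP; split; lra.
  have := ltr_cos hx hn; rewrite (_ : x / 2 < t - x / 2); last by lra.
  by move=> hc; rewrite hc lt_eqF.
(* Beyond [pi] the cosine increases again. Reflection leads back to [[0, pi]], and [t < 2 * pi] says
   that the reflected angle still exceeds [x / 2]. *)
have -> : cos (t - x / 2) = cos (pi *+ 2 - (t - x / 2)).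
  by rewrite [in RHS]addrC cosD2pi cosN.
have hn : pi *+ 2 - (t - x / 2) \in `[0, pi].
  by rewrite in_itv /= -mulr_natl; apply/andP; split; lra.
have := ltr_cos hx hn; rewrite (_ : x / 2 < _ = true); last first.
  by rewrite -mulr_natl; apply/idP; lra.
by move=> hc; rewrite hc lt_eqF.
Qed.


Lemma measurable_power_step (x0 K : R) n (D : set R) :
  measurable (D : set (measurableTypeR R)) ->
  measurable_fun (D : set (measurableTypeR R))
    (fun t => power_step K ((1 + cos (t - x0)) / 2) n).
Proof.
move=> mD; apply: measurable_funS (subsetT D) _ => //.
rewrite /power_step; apply: measurable_funB; first exact: measurable_cst.
apply: measurable_funX; apply: measurable_funB; first exact: measurable_cst.
apply: measurable_funX; apply: measurable_funM; last exact: measurable_cst.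
apply: measurable_funD; first exact: measurable_cst.
apply: continuous_measurable_fun => t; apply: continuous_comp.
  by apply: cvgB; [exact: cvg_id|exact: cvg_cst].
exact: continuous_cos.
Qed.

Lemma ae_notin_countable (A : set R) : countable A ->
  {ae mu, forall t : R, ~ A t}.
Proof.
move=> cA; exists A; split; last by move=> t /= /contrapT.
  by apply: countable_measurable => // t; exact: measurable_set1.
exact: countable_lebesgue_measure0.
Qed.

Lemma arc_integral0 (phi : R -> R) :
  mu.-integrable period (EFin \o phi) ->
  (forall x0 K n,
    \int[mu]_(t in period) (power_step K ((1 + cos (t - x0)) / 2) n * phi t) = 0) ->
  forall x : R, 0 < x < 2 * pi -> \int[mu]_(t in `[0, x]) phi t = 0.
Proof.
move=> iphi H x x02; have /andP[x0 x2] := x02.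
have mP := @measurable_period R.
have mphi : measurable_fun (period : set (measurableTypeR R)) phi.
  by apply/measurable_EFinP; exact: measurable_int iphi.
have pi0 := @pi_gt0 R.
have hx : x / 2 \in `[0, pi] by rewrite in_itv /=; apply/andP; split; lra.
have h0 : (0 : R) \in `[0, pi] by rewrite in_itv /= lexx ltW.
have hpi : (pi : R) \in `[0, pi] by rewrite in_itv /= lexx ltW.
have cx1 : cos (x / 2) < 1 by have := ltr_cos h0 hx; rewrite cos0 => ->; lra.
have cxN1 : -1 < cos (x / 2) by have := ltr_cos hx hpi; rewrite cospi => ->; lra.
(* This choice makes [K * y t] cross 1 exactly at the ends of the arc; [K] exceeds 1 because
   [cos (x / 2) < 1]. *)
pose K := 2 / (1 + cos (x / 2)).
have K1 : 1 < K by rewrite /K ltr_pdivlMr; lra.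
pose y t := (1 + cos (t - x / 2)) / 2.
have y01 t : 0 <= y t <= 1.
  have := cos_geN1 (t - x / 2); have := cos_le1 (t - x / 2).
  by rewrite /y => ? ?; apply/andP; split; lra.
pose fn n t := (power_step K (y t) n * phi t)%:E.
pose f t := ((phi \_ `[0, x]) t)%:E.
have sub : `[0, x]%classic `<=` period.
  by move=> t; rewrite /Defs.period /= !in_itv /= => /andP[-> tx] /=; lra.
have mfn n : measurable_fun (period : set (measurableTypeR R)) (fn n).
  apply/measurable_EFinP; apply: measurable_funM => //.
  exact: measurable_power_step.
have mf : measurable_fun (period : set (measurableTypeR R)) f.
  have mI : measurable (`[0, x]%classic : set (measurableTypeR R)).
    exact: measurable_itv.
  apply/measurable_EFinP; apply/(measurable_restrict _ mI mP).
  by apply: measurable_funS mphi => // t [].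
have cvgf : {ae mu, forall t, period t -> fn ^~ t @ \oo --> f t}.
  (* At these three points [K * y t = 1], the case that [cvg_power_step] excludes. *)
  have cA : countable [set 0; x; 2 * pi] by apply: finite_set_countable; exact: finite_set3.
  apply: (@filterS _ _ (ae_filter_ringOfSetsType mu) _ _ _ (ae_notin_countable cA)).
  move=> t tA; rewrite /Defs.period /= in_itv /= => t02.
  have [tn0 tnx tn2] : [/\ t != 0, t != x & t != 2 * pi].
    by split; apply/eqP => tE; apply: tA; rewrite tE /=; [left; left|left; right|right].
  have [lt_iff neq] := arc_cos x02 t02 tn0 tnx tn2.
  have Ky : K * y t = (1 + cos (t - x / 2)) / (1 + cos (x / 2)).
    by rewrite /K /y; field; lra.
  have Kyn : K * y t != 1.
    apply: contra neq; rewrite Ky => /eqP E; apply/eqP.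
    by move: E => /(canRL (mulfVK _)); rewrite mul1r => /(_ _)/addrI; apply; lra.
  have Kylt : (K * y t < 1) = (x < t).
    by rewrite Ky ltr_pdivrMr ?mul1r ?ltrD2l //; lra.
  have := cvg_power_step K1 (y01 t) Kyn; rewrite Kylt => cv.
  have -> : f t = ((if x < t then 0 else 1) * phi t)%:E.
    rewrite /f patchE mem_setE in_itv /=; case: ltP => xt.
      by rewrite andbF mul0r.
    by move: t02 => /andP[-> _]; rewrite mul1r.
  apply: cvg_EFin; first by near=> n.
  apply: cvgM; [exact: cv|exact: cvg_cst].
have ig : mu.-integrable period (EFin \o (fun t => `|phi t|)) by exact: integrable_norm.
have bnd : {ae mu, forall t n, period t -> (`|fn n t| <= (EFin \o (fun t => `|phi t|)%R) t)%E}.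
  apply: (@aeW _ _ _ mu) => t n _ /=; rewrite lee_fin normrM ler_piMl //.
  by have /andP[p0 p1] := power_step_ge0_le1 K n (y01 t); rewrite ger0_norm.
have [intf _ cvi] := dominated_convergence mP mfn mf cvgf ig bnd.
have if0 : (\int[mu]_(t in period) f t)%E = 0%E.
  apply: (cvg_unique _ cvi) => //.
  rewrite (_ : [sequence _]_n = fun=> 0%E); first exact: cvg_cst.
  apply/funext => n /=.
  rewrite -[LHS]fineK; last first.
    apply: integrable_fin_num => //; apply: le_integrable ig => // t _ /=.
    rewrite lee_fin normr_id normrM ler_piMl //.
    by have /andP[p0 p1] := power_step_ge0_le1 K n (y01 t); rewrite ger0_norm.
  by rewrite -[fine _]/(\int[mu]_(t in period) _) H.
have -> : `[0, x]%classic = period `&` `[0, x] by rewrite setIC; apply/esym/setIidPl.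
by rewrite Rintegral_mkcondr /Rintegral if0.
Unshelve. all: by end_near. Qed.

Lemma integral0_ae0 (phi : R -> R) :
  mu.-integrable period (EFin \o phi) ->
  (forall x : R, 0 < x < 2 * pi -> \int[mu]_(t in `[0, x]) phi t = 0) ->
  {ae mu, forall t, period t -> phi t = 0}.
Proof.
move=> iphi phi0.
have mP := @measurable_period R.
have iT : mu.-integrable setT (EFin \o (phi \_ period)).
  have /= := (@integrable_mkcond _ (measurableTypeR R) R mu period (EFin \o phi) mP).1 iphi.
  by rewrite restrict_EFin.
have loc : locally_integrable setT (phi \_ period) by exact: integrable_locally.
have := @FTC1 R (phi \_ period) (BLeft 0) _ loc => /(_ _)/=.
have iy (y : R) : mu.-integrable [set` Interval (BLeft 0) (BRight y)]
    (EFin \o (phi \_ period)).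
  by apply: integrableS iT => //; exact: measurable_itv.
move=> /(_ iy) ftc.
have cA : countable [set 0; 2 * pi : R] by apply: finite_set_countable; exact: finite_set2.
apply: (@filterS2 _ _ (ae_filter_ringOfSetsType mu) _ _ _ _ ftc (ae_notin_countable cA)).
move=> t ft tA; rewrite /Defs.period /= in_itv /= => /andP[t0 t2].
have tn0 : t != 0 by apply/eqP => tE; apply: tA; left.
have tn2 : t != 2 * pi by apply/eqP => tE; apply: tA; right.
have t0' : 0 < t by rewrite lt_neqAle eq_sym tn0.
have t2' : t < 2 * pi by rewrite lt_neqAle tn2.
have [|_] := ft; first by [].
rewrite patchE mem_setE in_itv /= t0 t2 /= => <-.
(* The primitive vanishes at every point near the interior point [t], so its derivative there is
   0. *)
rewrite derive1E (@near_eq_derive _ _ _ _ (fun=> 0)) ?derive_cst //.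
near=> s.
have s02 : 0 < s < 2 * pi.
  apply/andP; split; near: s; [exact: lt_nbhsr|exact: lt_nbhsl].
rewrite -[RHS](phi0 s s02); apply: eq_Rintegral => r.
rewrite inE /= in_itv /= => /andP[r0 rs]; rewrite patchE mem_setE in_itv /= r0 /=.
by rewrite (le_trans rs) // ltW //; case/andP: s02.
Unshelve. all: by end_near. Qed.

End UniquenessTheorem.

(** * Functions with summable Fourier coefficients *)

Section WienerClass.
Context {R : realType}.
Implicit Types (u v : R -> R[i]) (m k : int).

Local Notation normc := Normc.normc.
Local Notation mu := (@lebesgue_measure R).
Local Notation period := (@period R).
Let mP := @measurable_period R.

Lemma modes_vanish_ae0 u : modes_vanish u ->
  {ae mu, forall x, period x -> u x = 0}.
Proof.
move=> vu; have [[ru ju] _] := vu.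
(* Mode 0 of the product is its plain integral. As [power_step] is real, the real and imaginary
   parts of [u] can be tested separately. *)
have step x0 K n := (vanish_multiplier_power_step x0 K n vu).2 0.
have ae_re : {ae mu, forall x, period x -> complex.Re (u x) = 0}.
  apply: integral0_ae0 => //; apply: arc_integral0 => // x0 K n.
  have /(congr1 (@complex.Re R)) /= E := step x0 K n.
  rewrite -[RHS]E; apply: eq_Rintegral => x _.
  by rewrite mul0r expi0 mul1r ReM /= mul0r subr0.
have ae_im : {ae mu, forall x, period x -> complex.Im (u x) = 0}.
  apply: integral0_ae0 => //; apply: arc_integral0 => // x0 K n.
  have /(congr1 (@complex.Im R)) /= E := step x0 K n.
  rewrite -[RHS]E; apply: eq_Rintegral => x _.
  by rewrite mul0r expi0 mul1r ImM /= mul0r addr0.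
apply: (@filterS2 _ _ (ae_filter_ringOfSetsType mu) _ _ _ _ ae_re ae_im).
by move=> x hr hi Dx; apply: complexP; rewrite ?hr ?hi.
Qed.

Lemma cintegral_mode_fourier u m :
  cintegral period (fun x => expi (m%:~R * x) * u x) = (2 * pi)%:C * fourier u (- m).
Proof.
rewrite /fourier mulrA -rmorphM mulfV ?lt0r_neq0 ?two_pi_gt0 // mul1r.
by apply: eq_cintegral => x _; rewrite rmorphN mulNr opprK.
Qed.

Lemma fourierD u v m : cintegrable period u -> cintegrable period v ->
  fourier (fun x => u x + v x) m = fourier u m + fourier v m.
Proof.
move=> iu iv; rewrite /fourier; under eq_cintegral do rewrite mulrDr -!mulNr.
by rewrite cintegralD ?mulrDr //; do 1?[under eq_cintegral do rewrite -mulNr];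
  try exact: cintegrable_modeM; rewrite -!mulrDr; congr (_ * (_ + _));
  apply: eq_cintegral => x _; rewrite mulNr.
Qed.

Lemma fourierZ (c : R[i]) u m : cintegrable period u ->
  fourier (fun x => c * u x) m = c * fourier u m.
Proof.
move=> iu; rewrite /fourier; under eq_cintegral do rewrite mulrCA -mulNr.
rewrite cintegralZ //; last exact: cintegrable_modeM.
by rewrite mulrCA; congr (_ * (_ * _)); apply: eq_cintegral => x _; rewrite mulNr.
Qed.

Lemma fourier0 m : fourier (fun=> 0 : R[i]) m = 0.
Proof.
rewrite /fourier; under eq_cintegral do rewrite mulr0.
rewrite (_ : cintegral _ _ = 0) ?mulr0 //.
by apply: complexP; rewrite /= /Rintegral integral0.
Qed.

Lemma fourier_sum (I : Type) (s : seq I) (F : I -> R -> R[i]) m :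
  (forall i, cintegrable period (F i)) ->
  fourier (fun x => \sum_(i <- s) F i x) m = \sum_(i <- s) fourier (F i) m.
Proof.
move=> iF; elim: s => [|i s IHs].
  by under eq_fun do rewrite big_nil; rewrite big_nil fourier0.
under eq_fun do rewrite big_cons.
by rewrite big_cons -IHs fourierD //; exact: cintegrable_sum.
Qed.

Lemma ae_eq_fourier u v m : cintegrable period u -> cintegrable period v ->
  {ae mu, forall x, period x -> u x = v x} -> fourier u m = fourier v m.
Proof.
move=> iu iv uv; rewrite /fourier; congr (_ * _).
have mexpi w : cintegrable period w ->
    cmeasurable period (fun x => expi (- (m%:~R * x)) * w x).
  move=> iw; apply: cmeasurable_integrable.
  by under eq_fun do rewrite -mulNr; exact: cintegrable_modeM.
apply: (ae_eq_cintegral mP); [exact: mexpi|exact: mexpi|].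
by apply: (@filterS _ _ (ae_filter_ringOfSetsType mu) _ _ _ uv) => x h /h ->.
Qed.

Lemma fourier_conj u m : cintegrable period u ->
  fourier (fun x => ((u x)^*)%R) m = ((fourier u (- m))^*)%R.
Proof.
move=> iu; rewrite /fourier conjM conj_real; congr (_ * _).
have [rm jm] : cintegrable period (fun x => expi (- ((- m)%:~R * x)) * u x).
  by under eq_fun do rewrite -mulNr; exact: cintegrable_modeM.
rewrite conjCE; apply: complexP => /=.
  apply: eq_Rintegral => x _; rewrite conjCE !ReM /= rmorphN mulNr opprK.
  by rewrite cosN sinN; case: (u x) => a b /=; ring.
rewrite -mulN1r -RintegralZl //; apply: eq_Rintegral => x _.
have -> : - ((- m)%:~R * x) = m%:~R * x by rewrite rmorphN mulNr opprK.
by rewrite conjCE !ImM /= cosN sinN; case: (u x) => a b /=; ring.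
Qed.

(** Up to null sets, the Wiener algebra on one period. It contains [sobolev rho] for rho > 1/2, is a
    linear space, and receives the values of both nonlinearities, which makes every sum below
    absolutely convergent. *)
Record wiener u : Prop := Wiener {
  wiener_integrable : cintegrable period u;
  wiener_summable : csummable setT (fourier u) }.

Lemma wiener_inversion u : wiener u ->
  {ae mu, forall x, period x -> u x = fourier_series (fourier u) x}.
Proof.
move=> [iu su]; have is_ := cintegrable_fourier_series su.
have isN := cintegrableZ mP (-1) is_.
have : {ae mu, forall x, period x -> u x + -1 * fourier_series (fourier u) x = 0}.
  apply: modes_vanish_ae0; split; first exact: cintegrableD.
  move=> m; rewrite cintegral_mode_fourier fourierD // fourierZ //.
  by rewrite fourier_fourier_series // mulN1r subrr mulr0.
apply: (@filterS _ _ (ae_filter_ringOfSetsType mu)) => x h /h /eqP.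
by rewrite mulN1r subr_eq0 => /eqP.
Qed.

Lemma wiener_fourier_series (f : int -> R[i]) : csummable setT f ->
  wiener (fourier_series f).
Proof.
move=> sf; split; first exact: cintegrable_fourier_series.
by apply: (csummable_le _ sf) => m _; rewrite fourier_fourier_series.
Qed.

Lemma wiener_cmeasurable u : wiener u -> cmeasurable period u.
Proof. by move=> [iu _]; exact: cmeasurable_integrable. Qed.

Lemma wienerD u v : wiener u -> wiener v -> wiener (fun x => u x + v x).
Proof.
move=> [iu su] [iv sv]; split; first exact: cintegrableD.
by apply: (csummable_le _ (csummableD su sv)) => m _; rewrite fourierD.
Qed.

Lemma wienerZ (c : R[i]) u : wiener u -> wiener (fun x => c * u x).
Proof.
move=> [iu su]; split; first exact: cintegrableZ.
by apply: (csummable_le _ (csummableZ c su)) => m _; rewrite fourierZ.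
Qed.

Lemma wiener_sum (I : Type) (s : seq I) (F : I -> R -> R[i]) :
  (forall i, wiener (F i)) -> wiener (fun x => \sum_(i <- s) F i x).
Proof.
move=> wF; elim: s => [|i s IHs]; last first.
  by under eq_fun do rewrite big_cons; exact: wienerD.
under eq_fun do rewrite big_nil.
have f0 : csummable setT (fun _ : int => 0 : R[i]).
  rewrite /csummable /summable esum1 // => m _.
  by rewrite Normc.normc0 abse0.
split; first exact: cintegrable_cst.
by apply: (csummable_le _ f0) => m _; rewrite fourier0.
Qed.

Lemma csummable_bounded (T : choiceType) (f : T -> R[i]) : csummable setT f ->
  exists C : R, forall t, normc (f t) <= C.
Proof.
move=> sf; exists (fine (\esum_(t in [set: T]) `|(normc (f t))%:E|)%E) => t.
rewrite -lee_fin fineK -?summableE // (esumID [set t]) //.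
rewrite setTI esum_set1 // [X in (_ <= X + _)%E]gee0_abs ?lee_fin ?normc_ge0 //.
by rewrite leeDl // esum_ge0.
Qed.

Lemma csummable_mul (T : choiceType) (f g : T -> R[i]) (C : R) :
  (forall t, normc (g t) <= C) -> csummable setT f ->
  csummable setT (fun t => f t * g t).
Proof.
move=> gC; apply: (@csummable_bound _ _ _ C) => t _.
by rewrite Normc.normcM mulrC ler_wpM2r ?normc_ge0.
Qed.

(** Parseval without conjugation, so that one identity serves both invariants: [v = u] for the
    square, [v] the conjugate of [u] for the squared modulus. Only [u] is replaced by its series;
    [v] is integrated against modes. *)
Lemma wiener_pairing u v : wiener u -> wiener v ->
  cmeasurable period (fun x => v x * u x) ->
  cintegral period (fun x => v x * u x) =
    (2 * pi)%:C * csum setT (fun m => fourier u m * fourier v (- m)).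
Proof.
move=> wu [iv sv] mvu; have [iu su] := wu.
have [i1 E1] := fourier_series_pairing su iv.
rewrite (ae_eq_cintegral mP (g := fun x => v x * fourier_series (fourier u) x)) //.
- rewrite E1 -csumZ.
    by apply: eq_csum => m _; rewrite cintegral_mode_fourier mulrCA.
  have [C vC] := csummable_bounded sv.
  by apply: (@csummable_mul _ _ _ C).
- exact: cmeasurable_integrable.
- have := wiener_inversion wu.
  by apply: (@filterS _ _ (ae_filter_ringOfSetsType mu)) => x h /h ->.
Qed.

End WienerClass.

(** * From Sobolev regularity to summable coefficients *)

Section SobolevWiener.
Context {R : realType}.

Local Notation normc := Normc.normc.
Local Notation mu := (@lebesgue_measure R).
Local Notation period := (@period R).

(** Cauchy condensation. The indices from [2 ^ k - 1] to [2 ^ k.+1 - 2] stand for the integers from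
    [2 ^ k] to [2 ^ k.+1 - 1]: they are [2 ^ k] in number, each with term at most [r ^+ k], so the
    blocks are dominated by a geometric series of ratio [q = 2 * r < 1]. *)
Lemma powR_dyadic_sum (s : R) : 1 < s ->
  exists C : R, forall N, \sum_(0 <= n < N) n.+1%:R `^ (- s) <= C.
Proof.
move=> s1; pose a n : R := n.+1%:R `^ (- s).
have a0 n : 0 <= a n by exact: powR_ge0.
pose r : R := 2 `^ (- s); have r0 : 0 < r by rewrite powR_gt0.
have r2 : r < 2^-1.
  have l2 : 0 < ln (2 : R) by rewrite ln_gt0 // ltr1n.
  rewrite /r /powR pnatr_eq0 /= -[ltRHS](lnK (_ : 2^-1 \is Num.pos)) ?posrE //.
  by rewrite lnV ?posrE // ltr_expR mulNr ltrN2 ltr_pMl.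
pose q := 2 * r; have q1 : q < 1 by rewrite /q; lra.
have q0 : 0 < q by rewrite mulr_gt0.
have E k : (2 ^ k)%:R `^ (- s) = r ^+ k.
  by rewrite natrX -powR_mulrn // -powRrM mulrC powRrM powR_mulrn // powR_ge0.
have block k : \sum_((2 ^ k).-1 <= n < (2 ^ k.+1).-1) a n <= q ^+ k.
  rewrite (@le_trans _ _ (\sum_((2 ^ k).-1 <= n < (2 ^ k.+1).-1) r ^+ k)) //.
    rewrite big_nat_cond [leRHS]big_nat_cond; apply: ler_sum => n.
    rewrite andbT => /andP[kn _]; rewrite -E /a.
    have h2 : (2 ^ k <= n.+1)%N by rewrite -ltnS prednK ?expn_gt0 in kn *; lia.
    rewrite /powR !pnatr_eq0 expn_eq0 /= ler_expR !mulNr lerN2.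
    by rewrite ler_pM2l ?(lt_trans _ s1) // ler_ln ?posrE ?ltr0n ?expn_gt0 // ler_nat.
  rewrite sumr_const_nat -[leLHS]mulr_natl exprMn -natrX.
  by rewrite ler_wpM2r ?exprn_ge0 ?(ltW r0) // ler_nat expnS; lia.
have dyadic k : \sum_(0 <= n < (2 ^ k).-1) a n <= \sum_(0 <= j < k) q ^+ j.
  elim: k => [|k IHk]; first by rewrite !big_geq.
  rewrite (@big_cat_nat _ _ _ (2 ^ k).-1) //=; last first.
    by rewrite -!subn1 leq_sub2r // leq_exp2l.
  by rewrite big_nat_recr //= lerD.
exists (1 - q)^-1 => N.
have geo k : \sum_(0 <= j < k) q ^+ j <= (1 - q)^-1.
  have q1' : 0 < 1 - q by rewrite subr_gt0.
  rewrite -[leRHS]mul1r ler_pdivlMr // mulrC big_mkord -opprB mulNr -subrX1 opprB.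
  by rewrite lerBlDr lerDl exprn_ge0 // ltW.
apply: le_trans (geo N); apply: le_trans (dyadic N).
rewrite (@big_cat_nat _ _ _ N 0 (2 ^ N).-1) //=.
  by rewrite lerDl sumr_ge0.
by rewrite -ltnS prednK ?expn_gt0 // ltn_expl.
Qed.


Lemma japanese_gt0 (m : int) : 0 < japanese (R := R) m.
Proof. by rewrite /japanese; case: eqVneq => // m0; rewrite ltr0z normr_gt0. Qed.

(** For k >= 1 the codes 2k - 1 and 2k have absolute value k, and 2k + 1 <= 3k. The constant 3 is
    attained at code 2. *)
Lemma japanese_code_ge n : n.+1%:R / 3 <= japanese (R := R) (int_of_code n).
Proof.
rewrite ler_pdivrMr // /japanese /int_of_code.
have Hn : (n = odd n + n./2.*2)%N by rewrite odd_double_half.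
case: (boolP (odd n)) Hn => [_|_] Hn.
  rewrite (_ : (Negz n./2 == 0) = false) // NegzE normrN ger0_norm // -pmulrn -natrM ler_nat.
  by move: Hn; rewrite -muln2; lia.
rewrite add0n in Hn.
case: eqVneq => [/eqP|] n0.
  have -> : n = 0%N by move: n0; rewrite eqz_nat => /eqP h0; rewrite Hn h0.
  by rewrite mul1r ler1n.
rewrite ger0_norm // -pmulrn -natrM ler_nat.
by move: n0 Hn; rewrite -muln2 eqz_nat; lia.
Qed.

Lemma summable_japanese (s : R) : 1 < s ->
  summable [set: int] (fun m => (japanese (R := R) m `^ (- s))%:E).
Proof.
move=> s1; have [C HC] := powR_dyadic_sum s1.
rewrite /summable (reindex_esum _ _ _ _ int_of_code_bij) -nneseries_esumT //.
apply: (@le_lt_trans _ _ (C * 3 `^ s)%:E); last exact: ltry.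
apply: lime_le; first by apply: is_cvg_nneseries => n _ _; rewrite abse_ge0.
apply: nearW => N.
apply: (@le_trans _ _ (\sum_(0 <= n < N) (3 `^ s * n.+1%:R `^ (- s))%:E)%E).
  apply: lee_sum => n _; rewrite lee_fin ger0_norm ?powR_ge0 //.
  have := japanese_code_ge n; set j := japanese _ => jn.
  have j0 : 0 < j by exact: japanese_gt0.
  have -> : 3 `^ s * n.+1%:R `^ (- s) = (n.+1%:R / 3) `^ (- s) :> R.
    by rewrite powRM ?invr_ge0 // -powR_inv1 // -powRrM mulN1r opprK mulrC.
  rewrite !powRN lef_pV2 ?posrE ?powR_gt0 ?divr_gt0 //.
  by apply: ge0_ler_powR; rewrite ?nnegrE ?divr_ge0 ?(ltW j0) // ltW // (lt_trans _ s1).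
by rewrite sumEFin lee_fin -mulr_sumr mulrC ler_wpM2r ?powR_ge0.
Qed.

(** Instead of Cauchy-Schwarz, the termwise bound [t <= P^-1 + P * t ^+ 2] with [P] the Sobolev
    weight: the first family is summable since [2 * rho > 1], the second is the Sobolev norm.
    Similarly [t <= 1 + t ^+ 2] gives integrability from square integrability. *)
Lemma sobolev_wiener (rho : R) (u : R -> R[i]) : 2^-1 < rho ->
  sobolev rho u -> wiener u.
Proof.
move=> rho2 [_ [mr mi] L2 Hs].
have mu_u : cmeasurable period u.
  by split; [apply: measurable_funS (subsetT _) mr|apply: measurable_funS (subsetT _) mi].
have mn : measurable_fun (period : set (measurableTypeR R)) (fun x => normc (u x) ^+ 2).
  under eq_fun do rewrite sqr_normcE.
  by have [rm im] := mu_u; apply: measurable_funD; exact: measurable_funX.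
have iu : cintegrable period u.
  apply: (@cintegrable_le _ _ (@measurable_period R) _ (fun x => 1 + normc (u x) ^+ 2)) => //.
    move=> x _; have := sqr_ge0 (normc (u x) - 1); have := normc_ge0 (u x).
    by rewrite sqrrB1; move: (normc _) => t; nra.
  rewrite (_ : EFin \o _ = (EFin \o cst 1%R) \+ (EFin \o (fun x => normc (u x) ^+ 2)%R))%E //.
  apply: integrableD => //; first exact: measurable_period.
    by have [] := cintegrable_cst (1 : R[i]).
  apply/integrableP; split; first exact/measurable_EFinP.
  under eq_integral do rewrite gee0_abs ?lee_fin ?sqr_ge0 //.
  exact: L2.
split=> //.
have s1 : 1 < 2 * rho by lra.
have sj := summable_japanese s1.
have sh : summable [set: int]
    (fun m => (japanese m `^ (2 * rho) * normc (fourier u m) ^+ 2)%:E).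
  apply: le_lt_trans Hs; apply: le_esum => m _.
  by rewrite gee0_abs // lee_fin mulr_ge0 ?powR_ge0 // sqr_ge0.
apply: summable_le (summableD sj sh) => m _.
have j0 := japanese_gt0 m; move: (normc_ge0 (fourier u m)).
move: (normc (fourier u m)) => t t0; rewrite powRN; set P := _ `^ _.
have P0 : 0 < P by rewrite powR_gt0.
have h : 0 <= P^-1 + P * t ^+ 2.
  by rewrite addr_ge0 ?invr_ge0 ?mulr_ge0 ?sqr_ge0 ?(ltW P0).
rewrite -EFinD lee_fin !ger0_norm // -subr_ge0.
have -> : P^-1 + P * t ^+ 2 - t = P^-1 * ((P * t - 2^-1) ^+ 2 + 3 / 4).
  by field; rewrite gt_eqF.
by rewrite mulr_ge0 ?invr_ge0 ?ltW // ltr_wpDl ?sqr_ge0 // divr_gt0.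
Qed.

End SobolevWiener.

(** * Quadratic invariants of Runge-Kutta schemes *)

Section RungeKuttaAlgebra.

(** With [g j = B(u, K_j)] and [be j j' = B(K_j, K_j')] the left-hand side is [B(v, v) - B(u, u)]
    for the step [v = u + t * \sum_j b j * K_j]. The coefficient condition presents [b j * b j'] as
    the symmetrization of [b j * a j j'], so the quadratic part equals twice the double sum that the
    stage identities produce from the linear part with opposite sign. *)
Lemma rk_cancellation (F : comPzRingType) (J : finType) (t : F) (b g : J -> F)
    (a be : J -> J -> F) :
  (forall j j', b j' * b j = b j * a j j' + b j' * a j' j) ->
  (forall j j', be j j' = be j' j) ->
  (forall j, g j + t * \sum_j' a j j' * be j' j = 0) ->
  t * (\sum_j b j * g j) *+ 2 + t ^+ 2 * \sum_j \sum_j' b j * b j' * be j j' = 0.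
Proof.
move=> hab be_sym hg.
have -> : \sum_j \sum_j' b j * b j' * be j j' =
    (\sum_j \sum_j' b j * (a j j' * be j' j)) *+ 2.
  rewrite mulr2n [X in _ = _ + X]exchange_big -big_split; apply: eq_bigr => j _.
  rewrite -big_split; apply: eq_bigr => j' _ /=.
  by rewrite [b j * b j']mulrC hab (be_sym j' j); ring.
have -> : \sum_j b j * g j = - (t * \sum_j \sum_j' b j * (a j j' * be j' j)).
  rewrite mulr_sumr -sumrN; apply: eq_bigr => j _.
  rewrite -mulr_sumr -[g j](addrK (t * \sum_j' a j j' * be j' j)) hg sub0r.
  by rewrite mulrN mulrCA.
by rewrite mulrN mulNrn mulrA -expr2 mulrnAr addNr.
Qed.

Context {R : realType} {S : nat}.
Implicit Types (u v w : R -> R[i]).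

Notation stage_index := ('I_S.+1 * 'I_S.+1 * 'I_S.+1)%type.

Definition at_index (d : weights R S) (j : stage_index) : R := d j.1.1 j.1.2 j.2.

Definition stage_at (K : stages R S) (j : stage_index) : R -> R[i] :=
  K j.1.1 j.1.2 j.2.

Lemma combineE (d : weights R S) (K : stages R S) x :
  combine d K x = \sum_j (at_index d j)%:C * stage_at K j x.
Proof.
rewrite /combine pair_bigA /= pair_bigA /=.
by apply: eq_bigr => -[[p q] r].
Qed.

Section Form.
(** [B] is complex-valued but only assumed real-bilinear: [nlse_form] does not commute with complex
    scalars. *)
Context (B : (R -> R[i]) -> (R -> R[i]) -> R[i]).
Hypothesis B_sym : forall u v, wiener u -> wiener v -> B u v = B v u.
Hypothesis B_add : forall u v w, wiener u -> wiener v -> wiener w ->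
  B (fun x => u x + v x) w = B u w + B v w.
Hypothesis B_scale : forall (c : R) u w, wiener u -> wiener w ->
  B (fun x => c%:C * u x) w = c%:C * B u w.

Lemma form_sum (J : Type) (s : seq J) (d : J -> R) (K : J -> R -> R[i]) w :
  (forall j, wiener (K j)) -> wiener w ->
  B (fun x => \sum_(j <- s) (d j)%:C * K j x) w = \sum_(j <- s) (d j)%:C * B (K j) w.
Proof.
move=> wK ww; elim: s => [|j s IHs].
  rewrite big_nil; under eq_fun do rewrite big_nil.
  rewrite (_ : (fun=> 0) = (fun x : R => 0%:C * w x)); last first.
    by apply/funext => x; rewrite mul0r.
  by rewrite B_scale // mul0r.
rewrite big_cons -IHs; under eq_fun do rewrite big_cons.
have wdK i : wiener (fun x => (d i)%:C * K i x) by exact: (wienerZ _ (wK i)).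
by rewrite (B_add (wdK j) (wiener_sum s wdK) ww) (B_scale _ (wK j) ww).
Qed.

(** The step appears here without the linear flow. On coefficients the flow is a common multiplier
    of modulus one, which both applications remove beforehand. *)
Lemma rk_form_preserved (a : 'I_S.+1 -> 'I_S.+1 -> 'I_S.+1 -> weights R S)
    (b : weights R S) (tau : R) u (K : stages R S) :
  (forall p q r p' q' r' : 'I_S.+1,
      b p' q' r' * b p q r
      = b p q r * a p q r p' q' r' + b p' q' r' * a p' q' r' p q r) ->
  wiener u -> (forall p q r, wiener (K p q r)) ->
  (forall p q r, B (fun y => u y + tau%:C * combine (a p q r) K y) (K p q r) = 0) ->
  let v := fun x => u x + tau%:C * combine b K x in B v v = B u u.
Proof.
move=> hab wu wK stage0 v.
have wK' j : wiener (stage_at K j) by exact: wK.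
have wc (d : weights R S) : wiener (combine d K).
  rewrite (funext (combineE d K)).
  exact: (wiener_sum _ (fun j => wienerZ _ (wK' j))).
have B_combine (d : weights R S) w : wiener w ->
    B (combine d K) w = \sum_j (at_index d j)%:C * B (stage_at K j) w.
  move=> ww; rewrite -(form_sum _ _ wK' ww); congr (B _ w); apply/funext => x; exact: combineE.
have B_affine (d : weights R S) w : wiener w ->
    B (fun x => u x + tau%:C * combine d K x) w =
    B u w + tau%:C * \sum_j (at_index d j)%:C * B (stage_at K j) w.
  move=> ww.
  by rewrite (B_add wu (wienerZ _ (wc d)) ww) (B_scale _ (wc d) ww) (B_combine _ _ ww).
have wv : wiener v := wienerD wu (wienerZ _ (wc b)).
have Bv w : wiener w ->
    B v w = B u w + tau%:C * \sum_j (at_index b j)%:C * B (stage_at K j) w.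
  exact: B_affine.
have := @rk_cancellation R[i] stage_index tau%:C (fun j => (at_index b j)%:C)
  (fun j => B u (stage_at K j))
  (fun j j' => (at_index (a j.1.1 j.1.2 j.2) j')%:C)
  (fun j j' => B (stage_at K j) (stage_at K j')).
move=> /(_ _ _ _) E.
rewrite (Bv _ wv).
under eq_bigr => j _ do rewrite (B_sym (wK' j) wv) (Bv _ (wK' j)) mulrDr.
rewrite big_split /= (B_sym wu wv) (Bv _ wu).
transitivity (B u u + (tau%:C * (\sum_j (at_index b j)%:C * B u (stage_at K j)) *+ 2
  + tau%:C ^+ 2 * \sum_j \sum_j' (at_index b j)%:C * (at_index b j')%:C
     * B (stage_at K j) (stage_at K j'))).
  rewrite (eq_bigr (fun j => (at_index b j)%:C * B u (stage_at K j))); last first.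
    by move=> j _; rewrite (B_sym wu (wK' j)).
  rewrite [X in _ + _ * (_ + X)](_ : _ = tau%:C * \sum_j \sum_j'
      (at_index b j)%:C * (at_index b j')%:C * B (stage_at K j) (stage_at K j')).
    by ring.
  rewrite mulr_sumr; apply: eq_bigr => j _; rewrite mulrCA; congr (_ * _).
  rewrite mulr_sumr; apply: eq_bigr => j' _.
  by rewrite mulrA (B_sym (wK' j) (wK' j')).
rewrite E ?addr0 //.
- by move=> j j'; rewrite -!rmorphM -rmorphD hab.
- by move=> j j'; rewrite (B_sym (wK' j) (wK' j')).
- by move=> j; rewrite -(B_affine _ _ (wK' j)); exact: stage0.
Qed.

End Form.

End RungeKuttaAlgebra.

(** * The two invariants as forms in the Fourier coefficients *)

Section InvariantForms.
Context {R : realType}.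
Implicit Types (u v w : R -> R[i]).

Local Notation normc := Normc.normc.
Local Notation mu := (@lebesgue_measure R).
Local Notation period := (@period R).

(** The Fourier side of the mean of u v over a period. There is no conjugate, in accordance with the
    plain square in [I0_kdv]. *)
Definition kdv_form u v : R[i] :=
  csum [set: int] (fun m => fourier u m * fourier v (- m)).

Definition hermitian_form u v : R[i] :=
  csum [set: int] (fun m => fourier u m * ((fourier v m)^*)%R).

(* Twice the real part of the Hermitian form. *)
Definition nlse_form u v : R[i] := hermitian_form u v + hermitian_form v u.

Lemma set_bijN : set_bij [set: int] [set: int] (-%R : int -> int).
Proof.
split=> // [m k _ _ /oppr_inj //|m _]; exists (- m) => //; exact: opprK.
Qed.

Lemma wiener_mul_summable u (g : int -> R[i]) v : wiener u -> wiener v ->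
  (forall m, exists k, normc (g m) <= normc (fourier v k)) ->
  csummable setT (fun m => fourier u m * g m).
Proof.
move=> [_ su] [_ sv] gv; have [C vC] := csummable_bounded sv.
apply: (@csummable_mul _ _ _ _ C) => // m.
by have [k gk] := gv m; exact: le_trans gk (vC k).
Qed.

Lemma kdv_summable u v : wiener u -> wiener v ->
  csummable setT (fun m => fourier u m * fourier v (- m)).
Proof.
by move=> wu wv; apply: (wiener_mul_summable wu wv) => m; exists (- m).
Qed.

Lemma hermitian_summable u v : wiener u -> wiener v ->
  csummable setT (fun m => fourier u m * ((fourier v m)^*)%R).
Proof.
move=> wu wv; apply: (wiener_mul_summable wu wv) => m; exists m.
by rewrite normc_conj.
Qed.

Lemma kdv_form_sym u v : kdv_form u v = kdv_form v u.
Proof.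
rewrite /kdv_form (csum_reindex _ set_bijN); apply: eq_csum => m _ /=.
by rewrite opprK mulrC.
Qed.

Lemma kdv_formD u v w : wiener u -> wiener v -> wiener w ->
  kdv_form (fun x => u x + v x) w = kdv_form u w + kdv_form v w.
Proof.
move=> wu wv ww; rewrite /kdv_form -csumD; try exact: kdv_summable.
by apply: eq_csum => m _; rewrite fourierD ?mulrDl //; [case: wu|case: wv].
Qed.

Lemma kdv_formZ (c : R) u w : wiener u -> wiener w ->
  kdv_form (fun x => c%:C * u x) w = c%:C * kdv_form u w.
Proof.
move=> wu ww; rewrite /kdv_form -csumZ; last exact: kdv_summable.
by apply: eq_csum => m _; rewrite fourierZ ?mulrA //; case: wu.
Qed.

Lemma hermitian_formC u v : wiener u -> wiener v ->
  hermitian_form v u = ((hermitian_form u v)^*)%R.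
Proof.
move=> wu wv; rewrite /hermitian_form -csum_conj; last exact: hermitian_summable.
by apply: eq_csum => m _; rewrite conjM conjCK mulrC.
Qed.

Lemma hermitian_formD u v w : wiener u -> wiener v -> wiener w ->
  hermitian_form (fun x => u x + v x) w = hermitian_form u w + hermitian_form v w.
Proof.
move=> wu wv ww; rewrite /hermitian_form -csumD; try exact: hermitian_summable.
by apply: eq_csum => m _; rewrite fourierD ?mulrDl //; [case: wu|case: wv].
Qed.

Lemma hermitian_formZ (c : R[i]) u w : wiener u -> wiener w ->
  hermitian_form (fun x => c * u x) w = c * hermitian_form u w.
Proof.
move=> wu ww; rewrite /hermitian_form -csumZ; last exact: hermitian_summable.
by apply: eq_csum => m _; rewrite fourierZ ?mulrA //; case: wu.
Qed.

Lemma nlse_form_sym u v : nlse_form u v = nlse_form v u.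
Proof. exact: addrC. Qed.

Lemma nlse_formD u v w : wiener u -> wiener v -> wiener w ->
  nlse_form (fun x => u x + v x) w = nlse_form u w + nlse_form v w.
Proof.
move=> wu wv ww; rewrite /nlse_form.
rewrite ![hermitian_form w _]hermitian_formC //; try exact: wienerD.
by rewrite hermitian_formD // conjD addrACA.
Qed.

Lemma nlse_formZ (c : R) u w : wiener u -> wiener w ->
  nlse_form (fun x => c%:C * u x) w = c%:C * nlse_form u w.
Proof.
move=> wu ww; rewrite /nlse_form.
rewrite ![hermitian_form w _]hermitian_formC //; try exact: wienerZ.
by rewrite hermitian_formZ // conjM conj_real mulrDr.
Qed.

Lemma I0_kdv_form u : wiener u -> I0_kdv u = (2 * pi)%:C * kdv_form u u.
Proof.
move=> wu; have mu2 := cmeasurableM (wiener_cmeasurable wu) (wiener_cmeasurable wu).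
rewrite /kdv_form -(wiener_pairing wu wu mu2).
by apply: eq_cintegral => x _; rewrite expr2.
Qed.

Lemma wiener_conj u : wiener u -> wiener (fun x => ((u x)^*)%R).
Proof.
move=> [[ru ju] su]; have iu : cintegrable period u by [].
split.
  split.
    by apply: (eq_integrable (@measurable_period R) _ _ _ ru) => x _ /=; case: (u x).
  have jN := integrableN ju.
  by apply: (eq_integrable (@measurable_period R) _ _ _ jN) => x _ /=; case: (u x).
apply: (csummable_le (g := fourier u \o -%R)).
  by move=> m _; rewrite fourier_conj // normc_conj.
by rewrite -(csummable_reindex _ set_bijN).
Qed.

Lemma I0_nlse_form u : wiener u ->
  (I0_nlse u)%:C = (2 * pi)%:C * hermitian_form u u.
Proof.
move=> wu; have wc := wiener_conj wu.
have mcu := cmeasurableM (wiener_cmeasurable wc) (wiener_cmeasurable wu).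
rewrite /hermitian_form (eq_csum (g := fun m =>
    fourier u m * fourier (fun x => ((u x)^*)%R) (- m))).
  rewrite -(wiener_pairing wu wc mcu).
    apply: complexP; rewrite /= ?ReM.
      apply: eq_Rintegral => x _; rewrite sqr_normcE.
      by case: (u x) => a b /=; ring.
    rewrite (_ : (fun x => _) = fun=> 0); first by rewrite /Rintegral integral0.
    by apply/funext => x; case: (u x) => a b /=; ring.
by move=> m _; rewrite fourier_conj ?opprK //; case: wu.
Qed.

Lemma fourier_multiplierE (phi : int -> R[i]) u m :
  (forall k, normc (phi k) = 1) -> wiener u ->
  wiener (fourier_multiplier phi u) /\
  fourier (fourier_multiplier phi u) m = phi m * fourier u m.
Proof.
move=> phi1 [_ su]; have sphi : csummable setT (fun k => phi k * fourier u k).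
  by apply: (csummable_le _ su) => k _; rewrite Normc.normcM phi1 mul1r.
split; first exact: wiener_fourier_series.
by rewrite /fourier_multiplier fourier_fourier_series.
Qed.

Lemma wiener_combine S (d : weights R S) (K : stages R S) :
  (forall p q r, wiener (K p q r)) -> wiener (combine d K).
Proof.
move=> wK; rewrite (funext (combineE d K)).
by apply: wiener_sum => j; apply: wienerZ; exact: wK.
Qed.

Lemma fourier_combine S (d : weights R S) (K : stages R S) m :
  (forall p q r, wiener (K p q r)) ->
  fourier (combine d K) m =
    \sum_j (at_index d j)%:C * fourier (stage_at K j) m.
Proof.
move=> wK; rewrite (funext (combineE d K)).
rewrite fourier_sum => [|j]; last exact: (wiener_integrable (wienerZ _ (wK _ _ _))).
by apply: eq_bigr => j _; rewrite fourierZ //; case: (wK j.1.1 j.1.2 j.2).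
Qed.

(** In [rk_step] the flow acts on [u] and on each stage separately; on coefficients it factors out
    of the whole combination. *)
Lemma rk_step_fourier S (phi : int -> R[i]) (tau : R) (b : weights R S) u
    (K : stages R S) :
  (forall k, normc (phi k) = 1) -> wiener u -> (forall p q r, wiener (K p q r)) ->
  wiener (rk_step (fourier_multiplier phi) tau b u K) /\
  forall m, fourier (rk_step (fourier_multiplier phi) tau b u K) m =
    phi m * fourier (fun x => u x + tau%:C * combine b K x) m.
Proof.
move=> phi1 wu wK.
have wfK p q r : wiener (fourier_multiplier phi (K p q r)).
  by have [] := fourier_multiplierE 0 phi1 (wK p q r).
have wfu : wiener (fourier_multiplier phi u) by have [] := fourier_multiplierE 0 phi1 wu.
have wc := wiener_combine b wK.
have wcf := @wiener_combine _ b (fun p q r => fourier_multiplier phi (K p q r)) wfK.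
split; first by apply: wienerD => //; exact: wienerZ.
move=> m; rewrite /rk_step !fourierD;
  try solve [by case: wu|by case: wfu|by case: (wienerZ tau%:C wc)
    |by case: (wienerZ tau%:C wcf)].
rewrite !fourierZ; try solve [by case: wc|by case: wcf].
rewrite (fourier_combine _ _ wfK) (fourier_combine _ _ wK).
rewrite (fourier_multiplierE m phi1 wu).2 mulrDr.
congr (_ + _); rewrite mulrCA; congr (_ * _); rewrite mulr_sumr.
apply: eq_bigr => j _; rewrite /stage_at (fourier_multiplierE m phi1 (wK _ _ _)).2.
by rewrite mulrCA.
Qed.

End InvariantForms.

Section FiberSums.
Context {R : realType}.

(** Serves the convolution sums over [e t = m]: since [t] determines [m], the iterated sum is a
    single sum over all tuples, whose summability follows from that of products of coefficients. *)
Lemma csum_fiber (T : choiceType) (e : T -> int) (J : int -> set T)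
    (f : int -> T -> R[i]) :
  (forall m t, J m t <-> e t = m) -> csummable setT (fun t => f (e t) t) ->
  [/\ forall m, csummable (J m) (f m),
      csummable setT (fun m => csum (J m) (f m)) &
      csum setT (fun m => csum (J m) (f m)) = csum setT (fun t => f (e t) t)].
Proof.
move=> JE sf.
have be : set_bij [set: T] ([set: int] `*`` J) (fun t => (e t, t)).
  split=> [t _|t t' _ _ [] //|[m t] /= [_ /JE <-]].
  - by split=> //; exact/JE.
  - by exists t.
have sf' : csummable ([set: int] `*`` J) (fun k => f k.1 k.2).
  by rewrite (csummable_reindex _ be).
have [s1 s2] := csummable_fubini sf'; split=> // [m|]; first exact: s1.
by rewrite csum_fubini // (csum_reindex _ be).
Qed.

End FiberSums.

(** * The KdV nonlinearity *)

Section KdVCancellation.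
Context {R : realType}.
Implicit Types (w : R -> R[i]) (l m k : int).

Local Notation normc := Normc.normc.
Local Notation mu := (@lebesgue_measure R).
Local Notation period := (@period R).

(** Here [l] is the product m a b. Keeping only this product makes the symmetry in the three
    frequencies visible. *)
Definition phase_integral (T : R) (p : nat) (l : int) : R[i] :=
  cintegral `[0, T] (fun s => expi (- (3 * l%:~R) * s) * (s ^+ p)%:C).

Lemma cintegrable_phase (T c : R) p :
  cintegrable `[0, T] (fun s => expi (c * s) * (s ^+ p)%:C).
Proof.
have mT : measurable (`[0, T]%classic : set (measurableTypeR R)) by exact: measurable_itv.
apply: (@cintegrableM _ _ mT 1).
- exact: cmeasurable_mode.
- by move=> s _; rewrite normc_expi.
- split; apply: integrable_continuous => s /=; first exact: exprn_continuous.
  exact: cvg_cst.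
Qed.

Lemma phase_integral_bound (T : R) p : 0 <= T ->
  exists C : R, 0 <= C /\ forall l, l != 0 -> normc (phase_integral T p l) <= C / `|l%:~R|.
Proof.
move=> T0; have [C HC] := oscillatory_bound p T0.
exists `|C|; split=> // l l0.
pose c : R := - (3 * l%:~R).
have lR0 : l%:~R != 0 :> R by rewrite intr_eq0.
have c0 : c != 0 by rewrite oppr_eq0 mulf_neq0.
have hc : `|\int[mu]_(s in `[0, T]) (s ^+ p * cos (c * s))| <= C / `|c|.
  apply: (HC c _ (fun s => sin (c * s))) => //.
  - by move=> x; exact: is_derive_sinM.
  - exact: continuous_cosM.
  - by move=> x; exact: sin_max.
have hs : `|\int[mu]_(s in `[0, T]) (s ^+ p * sin (c * s))| <= C / `|c|.
  apply: (HC c _ (fun s => - cos (c * s))) => //.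
  - move=> x; have dx := is_derive_cosM c x.
    by rewrite -[c * _]opprK; exact: is_deriveN.
  - exact: continuous_sinM.
  - by move=> x; rewrite normrN; exact: cos_max.
rewrite (le_trans (normc_le_ReIm _)) //=.
have -> : \int[mu]_(s in `[0, T]) complex.Re (expi (c * s) * (s ^+ p)%:C) =
    \int[mu]_(s in `[0, T]) (s ^+ p * cos (c * s)).
  by apply: eq_Rintegral => s _; rewrite ReM /= mulr0 subr0 mulrC.
have -> : \int[mu]_(s in `[0, T]) complex.Im (expi (c * s) * (s ^+ p)%:C) =
    \int[mu]_(s in `[0, T]) (s ^+ p * sin (c * s)).
  by apply: eq_Rintegral => s _; rewrite ImM /= mulr0 add0r mulrC.
rewrite (le_trans (lerD hc hs)) // /c normrN normrM ger0_norm //.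
rewrite -mulrDl ler_pdivrMr ?mulr_gt0 ?normr_gt0 //.
rewrite [X in _ * X]mulrC mulrA divfK ?normr_eq0 //.
by have := ler_norm C; have := normr_ge0 C; lra.
Qed.

Definition kdv_coupling (T : R) (p : nat) (m a b : int) : R[i] :=
  cint_oriented 0 T (fun s =>
    'i%C * m%:~R * expi (- (3 * s * m%:~R * a%:~R * b%:~R)) * (s ^+ p)%:C).

Lemma kdv_couplingE (T : R) p m a b : 0 <= T ->
  kdv_coupling T p m a b = 'i%C * m%:~R * phase_integral T p (m * a * b).
Proof.
move=> T0; rewrite /kdv_coupling /cint_oriented T0 /phase_integral -cintegralZ.
- apply: eq_cintegral => s _; rewrite mulrA; congr (_ * expi _ * _).
  by rewrite !rmorphM /=; ring.
- exact: measurable_itv.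
- exact: cintegrable_phase.
Qed.

Lemma normc_int (m : int) : normc (m%:~R : R[i]) = `|m%:~R|.
Proof. by rewrite -normc_real rmorph_int. Qed.

(** The derivative contributes |a + b|, the oscillation at most C / |(a + b) a b|, and the quotient
    is at most C because nonzero integers have modulus at least 1. If a + b = 0, the derivative
    annihilates the term. *)
Lemma kdv_coupling_bound (T : R) p : 0 <= T ->
  exists C : R, forall a b, a != 0 -> b != 0 ->
    normc (kdv_coupling T p (a + b) a b) <= C.
Proof.
move=> T0; have [C [C0 HC]] := phase_integral_bound p T0.
exists C => a b a0 b0; rewrite kdv_couplingE // !Normc.normcM normc_i mul1r normc_int.
have [->|ab0] := eqVneq (a + b) 0; first by rewrite normr0 mul0r.
rewrite (le_trans (ler_wpM2l _ (HC _ _))) ?mulf_neq0 //.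
rewrite !rmorphM /= !normrM.
have ge1 (k : int) : k != 0 -> 1 <= `|k%:~R : R|.
  by move=> k0; rewrite -intr_norm -[1]/(1%:~R) ler_int -gtz0_ge1 normr_gt0.
have abR : 0 < `|(a + b)%:~R : R| by rewrite normr_gt0 intr_eq0.
rewrite mulrCA -mulrA invfM mulVKf ?gt_eqF //.
rewrite ler_piMr // invf_le1 ?mulr_gt0 ?(lt_le_trans ltr01 (ge1 _ _)) //.
by rewrite mulr_ege1 ?ge1.
Qed.

Variables (tau : R) (p : nat) (c : R) (w : R -> R[i]).
Hypotheses (tau0 : 0 < tau) (c0 : 0 <= c) (ww : wiener w) (w0 : fourier w 0 = 0).

Let T := c * tau.
Let T0 : 0 <= T. Proof. by rewrite mulr_ge0 // ltW. Qed.

Let term (m : int) (ab : int * int) : R[i] :=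
  kdv_coupling T p m ab.1 ab.2 * fourier w ab.1 * fourier w ab.2.

Let sum_of (ab : int * int) : int := ab.1 + ab.2.

Let sumP (m : int) (ab : int * int) :
  [set ab : int * int | ab.1 + ab.2 = m] ab <-> sum_of ab = m.
Proof. by []. Qed.

Let term_summable : csummable setT (fun ab => term (sum_of ab) ab).
Proof.
have [_ sw] := ww; have [C HC] := kdv_coupling_bound p T0.
apply: (csummable_bound (C := C) _ (csummableM sw sw)) => ab _.
rewrite /term /sum_of -mulrA Normc.normcM.
(* For a = 0 or b = 0 there is no oscillation to compensate the derivative; zero mean makes these
   terms vanish. *)
have [a0|a0] := eqVneq ab.1 0; first by rewrite a0 w0 mul0r Normc.normc0 !mulr0.
have [b0|b0] := eqVneq ab.2 0; first by rewrite b0 w0 mulr0 Normc.normc0 !mulr0.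
by rewrite ler_wpM2r ?normc_ge0 ?HC.
Qed.

Lemma wiener_F_kdv : wiener (F_kdv tau p c w).
Proof.
have [_ s2 _] := csum_fiber sumP term_summable.
by apply: wienerZ; apply: wiener_fourier_series; apply: csummableZ.
Qed.

Lemma fourier_F_kdv m : fourier (F_kdv tau p c w) m =
  (2^-1)%:C * ((tau ^- p.+1)%:C *
    csum [set ab : int * int | ab.1 + ab.2 = m] (term m)).
Proof.
have [_ s2 _] := csum_fiber sumP term_summable.
have s3 := csummableZ (tau ^- p.+1)%:C s2.
rewrite fourierZ; last exact: cintegrable_fourier_series.
by rewrite fourier_fourier_series.
Qed.

(* With k = - (a + b), the summand is -i k times a symmetric function of
   (a, b, k): its three cyclic shifts add up to 0. *)
Lemma kdv_cyclic_sum0 :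
  csum setT (fun ab => fourier w (- sum_of ab) * term (sum_of ab) ab) = 0.
Proof.
pose t ab := fourier w (- sum_of ab) * term (sum_of ab) ab.
have st : csummable setT t.
  have [_ sw] := ww; have [C HC] := csummable_bounded sw.
  have h := @csummable_mul _ _ _ (fun ab => fourier w (- sum_of ab)) C
    (fun ab => HC (- sum_of ab)) term_summable.
  by apply: (csummable_le _ h) => ab _; rewrite /t mulrC.
(* The rotation a -> b -> k -> a of the triple with a + b + k = 0, of which a pair records two
   entries. *)
pose sh (ab : int * int) : int * int := (ab.2, - (ab.1 + ab.2)).
have shK ab : sh (sh (sh ab)) = ab.
  by case: ab => a b; rewrite /sh /=; congr (_, _); lia.
have bsh : set_bij setT setT sh.
  split=> // [x y _ _ xy|y _]; first by rewrite -[x]shK -[y]shK xy.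
  by exists (sh (sh y)).
have s1 : csum setT t = csum setT (t \o sh) by exact: csum_reindex.
have st1 : csummable setT (t \o sh) by rewrite -(csummable_reindex _ bsh).
have s2 : csum setT (t \o sh) = csum setT (t \o sh \o sh) by exact: csum_reindex.
have st2 : csummable setT (t \o sh \o sh) by rewrite -(csummable_reindex _ bsh).
have tE a b : t (a, b) = fourier w (- (a + b)) *
    ('i%C * (a + b)%:~R * phase_integral T p ((a + b) * a * b) *
     fourier w a * fourier w b).
  by rewrite -(kdv_couplingE _ _ _ _ T0).
have D1 := csumD st st1.
have D2 := csumD (csummableD st st1) st2.
have sum3 : csum setT t *+ 3 = 0.
  rewrite -(_ : csum setT t + csum setT t + csum setT t = csum setT t *+ 3); last first.
    by move: (csum setT t) => X; rewrite mulrS mulr2n addrA.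
  rewrite {3}s1 s2 {2}s1 -D1 -D2 (eq_csum (g := fun=> 0)).
    by rewrite (csum_single (t := (0, 0))).
  move=> [a b] _.
  rewrite -[LHS]/(t (a, b) + t (b, - (a + b)) + t (- (a + b), - (b + - (a + b)))) !tE.
  move kE : (- (a + b)) => k.
  have e1 : a + b = - k by lia.
  have e2 : b + k = - a by lia.
  have e3 : k + - (b + k) = - b by lia.
  rewrite e3 e2 !opprK e1.
  (* In the three rotations the output frequency is - k, - a and - b in turn, so the phase is always
     - (a b k) and the phase integrals coincide. *)
  have -> : - k * a * b = - (a * b * k) by lia.
  have -> : - a * b * k = - (a * b * k) by lia.
  have -> : - b * k * a = - (a * b * k) by lia.
  rewrite !rmorphN /=.
  have E : (k%:~R + a%:~R + b%:~R : R[i]) = 0.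
    have kab : k + a + b = 0 by lia.
    by rewrite -2!intrD kab.
  set P := phase_integral _ _ _.
  move: (fourier w a) (fourier w b) (fourier w k) P => wa wb wk P.
  move: E; move: (k%:~R) (a%:~R) (b%:~R) => kR aR bR E.
  transitivity (- 'i%C * P * wa * wb * wk * (kR + aR + bR)); first by ring.
  by rewrite E mulr0.
by move/eqP: sum3; rewrite mulrn_eq0 => /eqP.
Qed.

Lemma kdv_form_F_kdv : kdv_form w (F_kdv tau p c w) = 0.
Proof.
have [s1 s2 s3] := csum_fiber sumP term_summable.
have [_ sw] := ww; have [C HC] := csummable_bounded sw.
have st : csummable setT (fun ab => fourier w (- sum_of ab) * term (sum_of ab) ab).
  have h := @csummable_mul _ _ _ (fun ab => fourier w (- sum_of ab)) C
    (fun ab => HC (- sum_of ab)) term_summable.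
  by apply: (csummable_le _ h) => ab _; rewrite mulrC.
have [q1 q2 q3] := csum_fiber (f := fun m ab => fourier w (- m) * term m ab) sumP st.
(* Reflecting the mode puts the coefficient of [F_kdv] at m and that of [w] at - m, which is the
   summand of [kdv_cyclic_sum0] after unfolding the fibres. *)
rewrite /kdv_form (csum_reindex _ (@set_bijN)).
rewrite (eq_csum (g := fun m => (2^-1)%:C * (tau ^- p.+1)%:C *
    csum [set ab : int * int | ab.1 + ab.2 = m] (fun ab => fourier w (- m) * term m ab))).
  by rewrite csumZ // q3 kdv_cyclic_sum0 mulr0.
move=> m _ /=; rewrite opprK fourier_F_kdv csumZ; last exact: s1.
by ring.
Qed.

End KdVCancellation.

(** * The NLSE nonlinearity *)

Section InterpolationBounds.
Context {R : realType} {sigma : nat} (tau : R) (gamma : 'I_sigma -> R).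
Hypotheses (tau0 : 0 < tau) (gamma_inj : injective gamma).

Local Notation normc := Normc.normc.
Local Notation interp := (interp tau gamma).

Lemma cmeasurableB (D : set R) (f g : R -> R[i]) :
  cmeasurable D f -> cmeasurable D g -> cmeasurable D (fun x => f x - g x).
Proof.
move=> [rf jf] [rg jg]; split.
  by under eq_fun do rewrite ReD ReN; exact: measurable_funB.
by under eq_fun do rewrite ImD ImN; exact: measurable_funB.
Qed.

Lemma normc_sum (I : Type) (s : seq I) (F : I -> R[i]) :
  normc (\sum_(i <- s) F i) <= \sum_(i <- s) normc (F i).
Proof.
elim: s => [|i s IHs]; first by rewrite !big_nil Normc.normc0.
by rewrite !big_cons (le_trans (le_normcD _ _)) // lerD2l.
Qed.

Lemma normcX (z : R[i]) n : normc (z ^+ n) = normc z ^+ n.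
Proof.
elim: n => [|n IHn]; first by rewrite !expr0 Normc.normc1.
by rewrite !exprS Normc.normcM IHn.
Qed.

(** The Lagrange basis, obtained by interpolating the indicator of a node. It is finite and
    independent of the interpolated function. *)
Definition lagrange (j : 'I_sigma) : {poly R[i]} :=
  interp (fun s => if s == tau * gamma j then 1 else 0).

Lemma interp_lagrange (f : R -> R[i]) :
  interp f = \sum_j f (tau * gamma j) *: lagrange j.
Proof.
have lagP j := (interpP (fun s => if s == tau * gamma j then 1 else 0 : R[i]) tau0 gamma_inj).1.
apply/esym; apply: (interpP f tau0 gamma_inj).2; split.
  rewrite (leq_trans (size_sum _ _ _)) //; apply/bigmax_leqP => j _.
  by rewrite (leq_trans (size_scale_leq _ _)) //; case: (lagP j).
move=> j; rewrite horner_sum (bigD1 j) //= big1 => [|i ij].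
  by rewrite hornerZ (lagP j).2 eqxx mulr1 addr0.
rewrite hornerZ (lagP i).2 (inj_eq (mulfI (lt0r_neq0 tau0))) (inj_eq gamma_inj).
by rewrite eq_sym (negPf ij) mulr0.
Qed.

Lemma poly_bound (P : {poly R[i]}) (T : R) : exists M : R,
  forall s : R, `|s| <= T -> normc P.[s%:C] <= M.
Proof.
exists (\sum_(i < size P) normc P`_i * T ^+ i) => s sT.
rewrite horner_coef (le_trans (normc_sum _ _)) //.
apply: ler_sum => i _; rewrite Normc.normcM normcX normc_real.
rewrite ler_wpM2l ?normc_ge0 // lerXn2r // nnegrE //.
exact: le_trans sT.
Qed.

(** Interpolation is a combination of fixed polynomials with the nodal values as coefficients, so
    the bound is uniform over all unimodular [f], in particular over all frequencies in the
    kernel. *)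
Lemma interp_bound (T : R) : exists M : R,
  forall (f : R -> R[i]) (s : R), (forall t, normc (f t) = 1) -> `|s| <= T ->
    normc (interp f).[s%:C] <= M.
Proof.
have [M HM] := choice (fun j => poly_bound (lagrange j) T).
exists (\sum_j M j) => f s f1 sT.
rewrite interp_lagrange horner_sum (le_trans (normc_sum _ _)) //.
by apply: ler_sum => j _; rewrite hornerZ Normc.normcM f1 mul1r HM.
Qed.

(** The nodes are real, so conjugating the coefficients of the interpolant yields an interpolant of
    the conjugate, and uniqueness applies. *)
Lemma interp_conj (f : R -> R[i]) (s : R) :
  (((interp f).[s%:C])^*)%R = (interp (fun t => ((f t)^*)%R)).[s%:C].
Proof.
have [fs fE] := (interpP f tau0 gamma_inj).1.
rewrite -[in RHS]((interpP (fun t => ((f t)^*)%R) tau0 gamma_inj).2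
  (map_poly Num.conj (interp f))).
  by rewrite -[in RHS](conj_real s) horner_map.
split; first by rewrite size_map_poly.
by move=> j; rewrite -[in LHS](conj_real (tau * gamma j)) horner_map /= fE.
Qed.

Lemma cmeasurable_horner (P : {poly R[i]}) (D : set R) :
  cmeasurable D (fun s => P.[s%:C]).
Proof.
elim/poly_ind: P => [|P c IHP].
  by under eq_fun do rewrite horner0; exact: cmeasurable_cst.
under eq_fun do rewrite hornerMXaddC.
apply: cmeasurableD; last exact: cmeasurable_cst.
by apply: cmeasurableM => //; split; [exact: measurable_id|exact: measurable_cst].
Qed.

Lemma kernel_nlse_bound (T : R) : exists M : R, forall s k k1 k2 k3, `|s| <= T ->
  normc (kernel_nlse tau gamma s k k1 k2 k3) <= M.
Proof.
have [M HM] := interp_bound T.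
exists (M + M + M * M) => s k k1 k2 k3 sT; rewrite /kernel_nlse.
set P23 := _.[_]; set P01 := _.[_].
have h23 : normc P23 <= M by apply: HM => // t; exact: normc_expi.
have h01 : normc P01 <= M by apply: HM => // t; exact: normc_expi.
rewrite (le_trans (le_normcD _ _)) // normcN lerD //.
  by rewrite (le_trans (le_normcD _ _)) // lerD // Normc.normcM normc_expi mul1r.
by rewrite Normc.normcM ler_pM ?normc_ge0.
Qed.

(** The phases of [(k, k1)] and [(k2, k3)] carry opposite signs, so conjugation turns each into the
    form of the other, and the kernel is symmetric in its two factors. *)
Lemma kernel_nlse_conj s k k1 k2 k3 :
  ((kernel_nlse tau gamma s k k1 k2 k3)^*)%R = kernel_nlse tau gamma s k2 k3 k k1.
Proof.
have c01 : (fun t : R => ((expi (- (2 * t * k%:~R * k1%:~R)))^*)%R) =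
    (fun t => expi (2 * t * k%:~R * k1%:~R)).
  by apply/funext => t; rewrite expi_conj opprK.
have c23 : (fun t : R => ((expi (2 * t * k2%:~R * k3%:~R))^*)%R) =
    (fun t => expi (- (2 * t * k2%:~R * k3%:~R))).
  by apply/funext => t; rewrite expi_conj.
rewrite /kernel_nlse rmorphB rmorphD !rmorphM /= !interp_conj c01 c23.
rewrite !expi_conj opprK [X in _ - X]mulrC; congr (_ - _).
exact: addrC.
Qed.

Lemma cmeasurable_kernel_nlse (D : set R) k k1 k2 k3 :
  measurable (D : set (measurableTypeR R)) ->
  cmeasurable D (fun s => kernel_nlse tau gamma s k k1 k2 k3).
Proof.
move=> mD.
have m23 : cmeasurable D (fun s : R => expi (2 * s * k2%:~R * k3%:~R)).
  rewrite (_ : (fun s : R => _) = (fun s => expi ((2 * k2%:~R * k3%:~R) * s))).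
    exact: cmeasurable_mode.
  by apply/funext => s; congr expi; ring.
have m01 : cmeasurable D (fun s : R => expi (- (2 * s * k%:~R * k1%:~R))).
  rewrite (_ : (fun s : R => _) = (fun s => expi ((- (2 * k%:~R * k1%:~R)) * s))).
    exact: cmeasurable_mode.
  by apply/funext => s; congr expi; ring.
have mP P := cmeasurable_horner P D.
apply: cmeasurableB; last exact: cmeasurableM.
by apply: cmeasurableD; exact: cmeasurableM.
Qed.

End InterpolationBounds.

Section NLSECancellation.
Context {R : realType}.
Implicit Types k : int.

Local Notation normc := Normc.normc.
Local Notation mu := (@lebesgue_measure R).

Lemma cintegral_conj (D : set R) (f : R -> R[i]) :
  measurable (D : set (measurableTypeR R)) -> cintegrable D f ->
  cintegral D (fun x => ((f x)^*)%R) = ((cintegral D f)^*)%R.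
Proof.
move=> mD [rf jf]; rewrite conjCE; apply: complexP => /=.
  by apply: eq_Rintegral => x _; rewrite conjCE; case: (f x).
rewrite -mulN1r -RintegralZl //; apply: eq_Rintegral => x _.
by rewrite conjCE mulN1r; case: (f x).
Qed.

Context {sigma : nat} (tau c : R) (gamma : 'I_sigma -> R) (p : nat).
Hypotheses (tau0 : 0 < tau) (gamma_inj : injective gamma).

Let T := c * tau.

Definition nlse_coupling (k k1 k2 k3 : int) : R[i] :=
  cint_oriented 0 (c * tau) (fun s =>
    kernel_nlse tau gamma s k k1 k2 k3 * (s ^+ p)%:C).

Let cmeasurable_integrand (D : set R) k k1 k2 k3 :
  measurable (D : set (measurableTypeR R)) ->
  cmeasurable D (fun s => kernel_nlse tau gamma s k k1 k2 k3 * (s ^+ p)%:C).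
Proof.
move=> mD; apply: cmeasurableM; first exact: cmeasurable_kernel_nlse.
under eq_fun do rewrite rmorphXn.
by apply: cmeasurableX; split; [exact: measurable_id|exact: measurable_cst].
Qed.

Let integrand_bound : exists M : R, forall s k k1 k2 k3, `|s| <= `|T| ->
  normc (kernel_nlse tau gamma s k k1 k2 k3 * (s ^+ p)%:C) <= M.
Proof.
have [M HM] := kernel_nlse_bound tau0 gamma_inj `|T|.
exists (M * `|T| ^+ p) => s k k1 k2 k3 sT.
rewrite Normc.normcM normc_real normrX ler_pM ?normc_ge0 ?exprn_ge0 ?HM //.
by rewrite lerXn2r // nnegrE.
Qed.

Let itv_lty (x y : R) : (mu `[x, y] < +oo)%E.
Proof. by rewrite lebesgue_measure_itv /=; case: ifP; rewrite -?EFinB ltry. Qed.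

Lemma nlse_coupling_bound : exists C : R, forall k k1 k2 k3,
  normc (nlse_coupling k k1 k2 k3) <= C.
Proof.
have [M HM] := integrand_bound.
(* One bound for each orientation of the time interval, as [T] may be negative; the factor 2
   accounts for real and imaginary parts. *)
exists (Num.max (2 * M * fine (mu `[0, T]%classic)) (2 * M * fine (mu `[T, 0]%classic))).
move=> k k1 k2 k3; rewrite /nlse_coupling /cint_oriented -/T le_max.
case: ifPn => [T0|_].
  apply/orP; left; apply: normc_cintegral_le.
  - exact: measurable_itv.
  - exact: itv_lty.
  - by apply: cmeasurable_integrand; exact: measurable_itv.
  - move=> s; rewrite /= in_itv /= => /andP[s0 sT]; apply: HM.
    by rewrite !ger0_norm.
apply/orP; right; rewrite normcN; apply: normc_cintegral_le.
- exact: measurable_itv.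
- exact: itv_lty.
- by apply: cmeasurable_integrand; exact: measurable_itv.
- move=> s; rewrite /= in_itv /= => /andP[sT s0]; apply: HM.
  by rewrite !ler0_norm ?lerN2 // (le_trans sT).
Qed.

Lemma nlse_coupling_conj k k1 k2 k3 :
  ((nlse_coupling k k1 k2 k3)^*)%R = nlse_coupling k2 k3 k k1.
Proof.
have [M HM] := integrand_bound.
have E s : ((kernel_nlse tau gamma s k k1 k2 k3 * (s ^+ p)%:C)^*)%R =
    kernel_nlse tau gamma s k2 k3 k k1 * (s ^+ p)%:C.
  by rewrite conjM conj_real kernel_nlse_conj.
rewrite /nlse_coupling /cint_oriented -/T; case: ifPn => [T0|_].
  rewrite -cintegral_conj; first by apply: eq_cintegral => s _; exact: E.
    exact: measurable_itv.
  apply: cintegrable_bounded; first exact: measurable_itv.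
  - exact: itv_lty.
  - by apply: cmeasurable_integrand; exact: measurable_itv.
  - move=> s; rewrite /= in_itv /= => /andP[s0 sT]; apply: HM.
    by rewrite !ger0_norm.
rewrite rmorphN /= -cintegral_conj.
- by congr (- _); apply: eq_cintegral => s _; exact: E.
- exact: measurable_itv.
apply: cintegrable_bounded; first exact: measurable_itv.
- exact: itv_lty.
- by apply: cmeasurable_integrand; exact: measurable_itv.
- move=> s; rewrite /= in_itv /= => /andP[sT s0]; apply: HM.
  by rewrite !ler0_norm ?lerN2 // (le_trans sT).
Qed.

End NLSECancellation.

Section NLSEConservation.
Context {R : realType} {sigma : nat}.
Variables (mu tau c : R) (gamma : 'I_sigma -> R) (p : nat) (w : R -> R[i]).
Hypotheses (tau0 : 0 < tau) (gamma_inj : injective gamma) (ww : wiener w).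

Local Notation normc := Normc.normc.

Let coupling k k1 k2 k3 := nlse_coupling tau c gamma p k k1 k2 k3.

Let term (k : int) (l : int * int * int) : R[i] :=
  (tau ^- p.+1)%:C * coupling k l.1.1 l.1.2 l.2 *
  ((fourier w l.1.1)^*)%R * fourier w l.1.2 * fourier w l.2.

Let freq (l : int * int * int) : int := l.1.2 + l.2 - l.1.1.

Let freqP (k : int) (l : int * int * int) :
  [set l : int * int * int | k + l.1.1 = l.1.2 + l.2] l <-> freq l = k.
Proof. by rewrite /freq /=; split; lia. Qed.

Let term_summable : csummable setT (fun l => term (freq l) l).
Proof.
have [_ sw] := ww; have [C HC] := nlse_coupling_bound c p tau0 gamma_inj.
have scw : csummable setT (fun k => ((fourier w k)^*)%R).
  by apply: (csummable_le _ sw) => k _; rewrite normc_conj.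
apply: (csummable_bound (C := normc (tau ^- p.+1)%:C * C) _
  (csummableM (csummableM scw sw) sw)) => l _.
have -> : term (freq l) l = (tau ^- p.+1)%:C * coupling (freq l) l.1.1 l.1.2 l.2 *
    (((fourier w l.1.1)^*)%R * fourier w l.1.2 * fourier w l.2).
  by rewrite /term !mulrA.
rewrite Normc.normcM [normc (_ * coupling _ _ _ _)]Normc.normcM.
by rewrite ler_wpM2r ?normc_ge0 // ler_wpM2l ?normc_ge0 // HC.
Qed.

Let F_nlse_sumE (x : R) : F_nlse mu gamma tau p c w x =
  (- 'i%C * mu%:C) * fourier_series (fun k : int =>
    csum [set l : int * int * int | k + l.1.1 = l.1.2 + l.2] (term k)) x.
Proof.
congr (_ * fourier_series _ x); apply/funext => k.
by apply: eq_csum => -[[k1 k2] k3] _.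
Qed.

Lemma wiener_F_nlse : wiener (F_nlse mu gamma tau p c w).
Proof.
have [_ s2 _] := csum_fiber freqP term_summable.
rewrite (funext F_nlse_sumE); apply: wienerZ; exact: wiener_fourier_series.
Qed.

Lemma fourier_F_nlse k : fourier (F_nlse mu gamma tau p c w) k =
  (- 'i%C * mu%:C) *
  csum [set l : int * int * int | k + l.1.1 = l.1.2 + l.2] (term k).
Proof.
have [_ s2 _] := csum_fiber freqP term_summable.
rewrite (funext F_nlse_sumE) fourierZ; last exact: cintegrable_fourier_series.
by rewrite fourier_fourier_series.
Qed.

Let energy (l : int * int * int) : R[i] :=
  ((fourier w (freq l))^*)%R * term (freq l) l.

Let energy_summable : csummable setT energy.
Proof.
have [_ sw] := ww; have [C HC] := csummable_bounded sw.
have h := @csummable_mul _ _ _ (fun l => ((fourier w (freq l))^*)%R) C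
  (fun l => eq_ind_r (fun z => z <= C) (HC (freq l)) (normc_conj _)) term_summable.
by apply: (csummable_le _ h) => l _; rewrite /energy mulrC.
Qed.

(* Exchanging (k, k1) with (k2, k3) conjugates the summand. *)
Lemma energy_real : ((csum setT energy)^*)%R = csum setT energy.
Proof.
(* The tuple stores k1, k2, k3, and k is recovered by [freq]. After the exchange the stored
   frequencies are k3, k, k1 and the recovered one is k2. *)
pose sw (l : int * int * int) : int * int * int := (l.2, freq l, l.1.1).
have swK l : sw (sw l) = l.
  by case: l => [[k1 k2] k3]; rewrite /sw /freq /=; congr (_, _, _); lia.
have bsw : set_bij setT setT sw.
  split=> // [x y _ _ xy|y _]; first by rewrite -[x]swK -[y]swK xy.
  by exists (sw y).
rewrite -csum_conj // [RHS](csum_reindex _ bsw); apply: eq_csum => l _ /=.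
have fsw : freq (sw l) = l.1.2.
  by case: l => [[k1 k2] k3]; rewrite /sw /freq /=; lia.
rewrite /energy fsw /term /coupling [(sw l).1.1]/= [(sw l).1.2]/= [(sw l).2]/=.
have conjJ := nlse_coupling_conj c p tau0 gamma_inj.
rewrite -(conjJ (freq l) l.1.1 l.1.2 l.2).
move: (nlse_coupling _ _ _ _ _ _ _ _) (fourier w (freq l)) (fourier w l.1.1).
move: (fourier w l.1.2) (fourier w l.2) => z2 z3 J z z1.
by rewrite !conjM !conjCK conj_real; ring.
Qed.

Lemma nlse_form_F_nlse : nlse_form w (F_nlse mu gamma tau p c w) = 0.
Proof.
have wF := wiener_F_nlse; set F := F_nlse mu gamma tau p c w.
have [s1 s2 _] := csum_fiber freqP term_summable.
have [q1 q2 q3] := csum_fiber (f := fun k l => ((fourier w k)^*)%R * term k l) freqP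
  energy_summable.
have E : hermitian_form F w = (- 'i%C * mu%:C) * csum setT energy.
  rewrite -q3 -csumZ //; apply: eq_csum => k _.
  rewrite fourier_F_nlse (csumZ _ (s1 k)).
  move: (csum _ (term k)) ((fourier w k)^*)%R (- 'i%C * mu%:C) => X z C.
  by rewrite -mulrA [X * z]mulrC.
rewrite /nlse_form (hermitian_formC wF ww) E conjM energy_real.
move: (csum setT energy) => Z.
have -> : ((- 'i%C * mu%:C : R[i])^*)%R = 'i%C * mu%:C.
  by rewrite conjM conj_real conjCE; congr (_ * _); congr (_ +i* _); rewrite /= ?opprK ?oppr0.
by rewrite -mulrDl mulNr subrr mul0r.
Qed.

End NLSEConservation.

(** * Conservation *)

Section Conservation.
Context {R : realType} {S : nat}.
Variables (a : 'I_S.+1 -> 'I_S.+1 -> 'I_S.+1 -> weights R S) (b : weights R S).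
Hypothesis hab : forall p q r p' q' r' : 'I_S.+1,
  b p' q' r' * b p q r
  = b p q r * a p q r p' q' r' + b p' q' r' * a p' q' r' p q r.

Local Notation mu_ := (@lebesgue_measure R).
Local Notation period := (@period R).

(** The stage equations are used only through this lemma: the forms see a stage only through its
    coefficients. *)
Lemma ae_period_fourier u v : wiener u -> wiener v ->
  {ae mu_, forall x : R, u x = v x} -> fourier u = fourier v.
Proof.
move=> wu wv uv; apply/funext => m.
apply: ae_eq_fourier; [exact: wiener_integrable wu|exact: wiener_integrable wv|].
by apply: (@filterS _ _ (ae_filter_ringOfSetsType mu_) _ _ _ uv) => x uvx _.
Qed.

Lemma wiener_affine tau u (K : stages R S) (d : weights R S) :
  wiener u -> (forall p q r, wiener (K p q r)) ->
  wiener (fun y => u y + tau%:C * combine d K y).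
Proof. by move=> wu wK; exact: (wienerD wu (wienerZ _ (wiener_combine d wK))). Qed.

Lemma kdv_rk_conservation (tau : R) (c : 'I_S.+1 -> R) (u : R -> R[i])
    (K : stages R S) :
  0 < tau -> (forall q, 0 <= c q) ->
  wiener u -> fourier u 0 = 0 ->
  (forall p q r, wiener (K p q r)) -> (forall p q r, fourier (K p q r) 0 = 0) ->
  rk_stage_equations (F_kdv tau) tau c a u K ->
  I0_kdv (rk_step (airy_flow tau) tau b u K) = I0_kdv u.
Proof.
move=> tau0 c0 wu u0 wK K0 stages_eq.
pose phi m : R[i] := expi (tau * m%:~R ^+ 3).
have phi1 m : Normc.normc (phi m) = 1 by exact: normc_expi.
have [ws fs] := rk_step_fourier tau b phi1 wu wK.
have wv := wiener_affine tau b wu wK.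
apply: etrans (I0_kdv_form ws) (etrans _ (esym (I0_kdv_form wu))).
apply: (congr1 (GRing.mul (2 * pi)%:C)).
rewrite -(rk_form_preserved (B := kdv_form) (tau := tau) (K := K) _ _ _ hab wu wK).
- apply: eq_csum => m _; rewrite !fs mulrACA.
  (* The Airy symbol is odd in m, so the flow cancels in the pairing of m with - m. *)
  rewrite (_ : phi m * phi (- m) = 1) ?mul1r //.
  by rewrite /phi rmorphN /= exprNn -signr_odd /= expr1 mulN1r mulrN expi_mulN.
- by move=> u1 u2 _ _; exact: kdv_form_sym.
- by move=> u1 u2 u3 w1 w2 w3; exact: kdv_formD.
- by move=> d u1 u2 w1 w2; exact: kdv_formZ.
move=> p q r; have ww := wiener_affine tau (a p q r) wu wK.
(* The argument of [F_kdv] inherits zero mean from [u] and the stages, as required for the resonant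
   terms. *)
have w0 : fourier (fun y => u y + tau%:C * combine (a p q r) K y) 0 = 0.
  have wc := wiener_combine (a p q r) wK.
  rewrite (fourierD _ (wiener_integrable wu) (wiener_integrable (wienerZ tau%:C wc))).
  rewrite u0 add0r (fourierZ _ _ (wiener_integrable wc)) (fourier_combine _ _ wK).
  rewrite big1 ?mulr0 // => j _; rewrite K0 mulr0 //.
have E : fourier (K p q r) = fourier (F_kdv tau p (c q)
    (fun y => u y + tau%:C * combine (a p q r) K y)).
  apply: ae_period_fourier; [exact: wK|exact: wiener_F_kdv|exact: stages_eq].
rewrite /kdv_form E; exact: kdv_form_F_kdv.
Qed.

Lemma nlse_rk_conservation (mu : R) (sigma : nat) (gamma : 'I_sigma -> R)
    (tau : R) (c : 'I_S.+1 -> R) (u : R -> R[i]) (K : stages R S) :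
  injective gamma -> 0 < tau -> wiener u ->
  (forall p q r, wiener (K p q r)) ->
  rk_stage_equations (F_nlse mu gamma tau) tau c a u K ->
  I0_nlse (rk_step (schrodinger_flow tau) tau b u K) = I0_nlse u.
Proof.
move=> gamma_inj tau0 wu wK stages_eq.
pose phi m : R[i] := expi (- (tau * m%:~R ^+ 2)).
have phi1 m : Normc.normc (phi m) = 1 by exact: normc_expi.
have [ws fs] := rk_step_fourier tau b phi1 wu wK.
have wv := wiener_affine tau b wu wK.
apply: complexI.
apply: etrans (I0_nlse_form ws) (etrans _ (esym (I0_nlse_form wu))).
apply: (congr1 (GRing.mul (2 * pi)%:C)).
set v := (X in wiener X) in wv.
transitivity (hermitian_form v v).
  apply: eq_csum => m _; rewrite !fs conjM mulrACA /phi expi_conj expi_mulN.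
  by rewrite mul1r.
have : nlse_form v v = nlse_form u u.
  apply: (rk_form_preserved (B := nlse_form) (tau := tau) (K := K) _ _ _ hab wu wK).
  - by move=> u1 u2 _ _; exact: nlse_form_sym.
  - by move=> u1 u2 u3 w1 w2 w3; exact: nlse_formD.
  - by move=> d u1 u2 w1 w2; exact: nlse_formZ.
  move=> p q r; have ww := wiener_affine tau (a p q r) wu wK.
  have E : fourier (K p q r) = fourier (F_nlse mu gamma tau p (c q)
      (fun y => u y + tau%:C * combine (a p q r) K y)).
    by apply: ae_period_fourier; [exact: wK|exact: wiener_F_nlse|exact: stages_eq].
  rewrite /nlse_form /hermitian_form E; exact: nlse_form_F_nlse.
(* On the diagonal [nlse_form] is twice [hermitian_form]; the factor 2 is cancelled. *)
rewrite /nlse_form; move: (hermitian_form v v) (hermitian_form u u) => x y.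
rewrite -!mulr2n => /eqP.
by rewrite -subr_eq0 -mulrnBl mulrn_eq0 subr_eq0 => /eqP.
Qed.

End Conservation.

Lemma fourier_zero_mean (R : realType) (u : R -> R[i]) :
  zero_mean u -> fourier u 0 = 0.
Proof.
move=> u0; rewrite /fourier (eq_cintegral (g := u)) ?u0 ?mulr0 // => x _.
by rewrite mul0r oppr0 expi0 mul1r.
Qed.

Theorem theorem3p11 (R : realType) (S : nat)
    (a : 'I_S.+1 -> 'I_S.+1 -> 'I_S.+1 -> weights R S) (b : weights R S)
    (hab : forall p q r p' q' r' : 'I_S.+1,
      b p' q' r' * b p q r
      = b p q r * a p q r p' q' r' + b p' q' r' * a p' q' r' p q r) :
  (forall (tau : R) (c : 'I_S.+1 -> R) (rho : R)
      (u : R -> R[i]) (K : stages R S),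
    0 < tau ->
    (forall q, 0 <= c q <= 1) ->
    1 <= rho ->
    sobolev rho u -> zero_mean u ->
    (forall p q r, sobolev rho (K p q r) /\ zero_mean (K p q r)) ->
    rk_stage_equations (F_kdv tau) tau c a u K ->
    I0_kdv (rk_step (airy_flow tau) tau b u K) = I0_kdv u)
  /\
  (forall (mu : R) (sigma : nat) (gamma : 'I_sigma -> R)
      (tau : R) (c : 'I_S.+1 -> R) (rho : R)
      (u : R -> R[i]) (K : stages R S),
    (1 <= sigma)%N ->
    (forall j, 0 <= gamma j <= 1) ->
    (forall i j : 'I_sigma, (i < j)%N -> gamma i < gamma j) ->
    0 < tau ->
    2^-1 < rho ->
    sobolev rho u ->
    (forall p q r, sobolev rho (K p q r)) ->
    rk_stage_equations (F_nlse mu gamma tau) tau c a u K ->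
    I0_nlse (rk_step (schrodinger_flow tau) tau b u K) = I0_nlse u).
Proof.
split=> [tau c rho u K tau0 c01 rho1 su u0 sK stages_eq|].
  have rho2 : 2^-1 < rho by lra.
  apply: (kdv_rk_conservation hab tau0 _ _ _ _ _ stages_eq).
  - by move=> q; case/andP: (c01 q).
  - exact: sobolev_wiener rho2 su.
  - exact: fourier_zero_mean.
  - by move=> p q r; exact: (sobolev_wiener rho2 (sK p q r).1).
  - by move=> p q r; exact: (fourier_zero_mean (sK p q r).2).
move=> mu sigma gamma tau c rho u K _ _ gamma_mono tau0 rho2 su sK stages_eq.
have gamma_inj : injective gamma.
  move=> i j gij; case: (ltngtP (i : nat) (j : nat)) => [ij|ji|ij].
  - by have := gamma_mono i j ij; rewrite gij ltxx.
  - by have := gamma_mono j i ji; rewrite gij ltxx.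
  - exact: val_inj.
apply: (nlse_rk_conservation hab gamma_inj tau0 _ _ stages_eq).
  exact: sobolev_wiener rho2 su.
by move=> p q r; exact: (sobolev_wiener rho2 (sK p q r)).
Qed.
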